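(* Let $\epsilon \in (0,1/10)$ be a constant. Given a graph $G$ on $n$ nodes and a parameter $\Delta \geq (100 \log n/\epsilon^4)^{(30/\epsilon)\log(1/\epsilon)}$ such that the maximum degree of $G$ is at most $\Delta$, the algorithm StaticColor produces a proper $(1+61\epsilon)\Delta$-edge coloring of $G$ with probability at least $1-8/n^6$.
   Context: Let $T := \lfloor(1/\epsilon)\log(1/\epsilon)\rfloor$ and $K := \lceil (8/\epsilon^2)\log(1/\epsilon)\rceil$. Nibble$(H,D,\epsilon)$ on a graph $H=(V,E_H)$ uses palette $\mathcal{C}=[\lceil(1+\epsilon)D\rceil]$. Each edge $e$ independently receives a round $i_e\in[T+1]$ with $\Pr[i_e=i]=(1-\epsilon)^{i-1}\epsilon$ for $i\in[T]$ and $\Pr[i_e=T+1]=(1-\epsilon)^T$, and a color sequence $c_e(1),\dots,c_e(K)$ of i.i.d. uniform colors from $\mathcal{C}$. Let $S_i:=\{e: i_e=i\}$ and $N(u)$ be the edges incident on $u$. For $i=1,\dots,T$ in order: $P_i(u):=\mathcal{C}\setminus\{\tilde\chi(f): f\in N(u)\cap(S_1\cup\dots\cup S_{i-1})\}$, $P_i(u,v):=P_i(u)\cap P_i(v)$; each $e\in S_i$ sets $\tilde\chi(e):=c_e(\ell)$ for the smallest $\ell\in[K]$ with $c_e(\ell)\in P_i(e)$, or $\tilde\chi(e):=\bot$ if none exists. An edge $e\in S_i$ ($i\le T$) fails iff $\tilde\chi(e)=\bot$ or some edge $f\ne e$ of $S_i$ sharing an endpoint with $e$ has $\tilde\chi(f)=\tilde\chi(e)$;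 every edge of $S_{T+1}$ fails. Non-failed edges keep color $\tilde\chi(e)$; Nibble returns the set of failed edges. StaticColor$(G)$: let $\Delta':=\Delta^{1/(30T)}$ and $\eta:=\lceil\Delta/\Delta'\rceil$; place each edge of $G$ independently and uniformly at random into one of $\eta$ edge sets, forming subgraphs $\mathcal{G}_1,\dots,\mathcal{G}_\eta$ on $V$; run Nibble$(\mathcal{G}_j,(1+\epsilon)\Delta',\epsilon)$ for each $j$, using mutually disjoint palettes for different $j$; finally greedily color the union $H$ of all failed edges with a further disjoint set of $3\Delta(H)$ colors, where $\Delta(H)$ is the maximum degree of $H$. *)

(* Defs.v *)
From HB Require Import structures.
From mathcomp Require Import all_boot all_order all_algebra.
From mathcomp Require Import reals exp.

Set Implicit Arguments.
Unset Strict Implicit.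
Unset Printing Implicit Defensive.
Import Order.TTheory GRing.Theory Num.Theory.
Local Open Scope ring_scope.

(** * Finite probability: mass functions on finite types *)

Definition prob (R : realType) (Omega : finType) (w : Omega -> R)
    (A : pred Omega) : R := \sum_(omega | A omega) w omega.

Definition uniform_pmf (R : realType) (A : finType) (a : A) : R := #|A|%:R^-1.

Definition prod_pmf (R : realType) (A B : finType) (p : A -> R) (q : B -> R)
    (x : A * B) : R := p x.1 * q x.2.

Definition iid_pmf (R : realType) (I A : finType) (p : A -> R)
    (x : {ffun I -> A}) : R := \prod_(i : I) p (x i).

(** * Graphs and edge colorings *)

(* A simple graph on the vertex type V is given by its set E of edges, each
   edge being the 2-element set of its endpoints.  Subgraphs on V are sets of
   elements of [edge E]. *)
Definition simple_graph (V : finType) (E : {set {set V}}) : Prop :=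
  forall e, e \in E -> #|e| = 2.

Definition edge (V : finType) (E : {set {set V}}) : finType :=
  {e : {set V} | e \in E}.

Definition incident (V : finType) (E : {set {set V}}) (u : V) (e : edge E) :
  bool := u \in val e.

Definition adjacent (V : finType) (E : {set {set V}}) (e f : edge E) : bool :=
  (e != f) && [exists u, incident u e && incident u f].

Definition max_degree (V : finType) (E : {set {set V}}) (F : {set edge E}) :
  nat := \max_(u : V) #|[set e in F | incident u e]|.

(* Colorings are partial ([None] stands for "no color"); a proper k-edge
   coloring colors every edge, with colors 0, ..., k-1. *)
Definition proper_edge_coloring (V : finType) (E : {set {set V}}) (k : nat)
    (chi : edge E -> option nat) : bool :=
  [forall e, if chi e is Some c then (c < k)%N else false] &&
  [forall e, forall f, adjacent e f ==> (chi e != chi f)].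

(** * Nibble *)

Definition nceil (R : realType) (x : R) : nat := `|Num.ceil x|%N.

Definition nrounds (R : realType) (eps : R) : nat :=
  Num.truncn (eps^-1 * ln eps^-1).

Definition ntries (R : realType) (eps : R) : nat :=
  nceil (8 / eps ^+ 2 * ln eps^-1).

Definition palette_size (R : realType) (eps D : R) : nat :=
  nceil ((1 + eps) * D).

(* Rounds are numbered from 0: the value i < T is the (i+1)-st round, and the
   value T is the last class S_{T+1}. *)
Definition round_pmf (R : realType) (eps : R) (i : 'I_(nrounds eps).+1) : R :=
  if (i < nrounds eps)%N then (1 - eps) ^+ i * eps
  else (1 - eps) ^+ nrounds eps.

(* For each edge of the ambient graph, its round and its color sequence.  A run
   of Nibble on a subgraph H only reads the entries of the edges of H. *)
Definition nibble_seed (R : realType) (V : finType) (E : {set {set V}})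
    (eps D : R) : finType :=
  {ffun edge E -> 'I_(nrounds eps).+1
                  * {ffun 'I_(ntries eps) -> 'I_(palette_size eps D)}}.

Definition nibble_pmf (R : realType) (V : finType) (E : {set {set V}})
    (eps D : R) : nibble_seed E eps D -> R :=
  iid_pmf (prod_pmf (@round_pmf R eps) (iid_pmf (@uniform_pmf R _))).

Definition round_of (R : realType) (V : finType) (E : {set {set V}})
    (eps D : R) (s : nibble_seed E eps D) (e : edge E) : nat := (s e).1.

(* P_i(u), where chi holds the tentative colors of the rounds before i *)
Definition vertex_palette (R : realType) (V : finType) (E : {set {set V}})
    (eps D : R) (H : {set edge E}) (s : nibble_seed E eps D)
    (chi : edge E -> option 'I_(palette_size eps D)) (i : nat) (u : V) :
    {set 'I_(palette_size eps D)} :=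
  [set c | [forall f in H,
     incident u f && (round_of s f < i)%N ==> (chi f != Some c)]].

Definition edge_palette (R : realType) (V : finType) (E : {set {set V}})
    (eps D : R) (H : {set edge E}) (s : nibble_seed E eps D)
    (chi : edge E -> option 'I_(palette_size eps D)) (i : nat) (e : edge E) :
    {set 'I_(palette_size eps D)} :=
  \bigcap_(u | incident u e) vertex_palette H s chi i u.

(* c_e(l) for the smallest l such that c_e(l) lies in P, if any *)
Definition first_color (R : realType) (V : finType) (E : {set {set V}})
    (eps D : R) (s : nibble_seed E eps D) (e : edge E)
    (P : {set 'I_(palette_size eps D)}) : option 'I_(palette_size eps D) :=
  ohead [seq c <- [seq (s e).2 l | l <- enum 'I_(ntries eps)] | c \in P].

(* The tentative coloring after the first m rounds *)
Fixpoint tentative_upto (R : realType) (V : finType) (E : {set {set V}})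
    (eps D : R) (H : {set edge E}) (s : nibble_seed E eps D) (m : nat) :
    edge E -> option 'I_(palette_size eps D) :=
  if m is i.+1 then
    let chi := tentative_upto H s i in
    fun e => if (e \in H) && (round_of s e == i)
             then first_color s e (edge_palette H s chi i e) else chi e
  else fun=> None.

Definition tentative (R : realType) (V : finType) (E : {set {set V}})
    (eps D : R) (H : {set edge E}) (s : nibble_seed E eps D) :
    edge E -> option 'I_(palette_size eps D) :=
  tentative_upto H s (nrounds eps).

Definition nibble_failed (R : realType) (V : finType) (E : {set {set V}})
    (eps D : R) (H : {set edge E}) (s : nibble_seed E eps D) :
    {set edge E} :=
  [set e in H |
    [|| round_of s e == nrounds eps,
        tentative H s e == None |
        [exists f in H, [&& adjacent f e, round_of s f == round_of s e &
                            tentative H s f == tentative H s e]]]].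

(** * Greedy coloring *)

(* Edges of H are colored one at a time, following [order H], with colors
   0, ..., k-1; among the colors not used by adjacent edges colored before,
   the choice is made by [pick].  An edge with no available color stays
   uncolored. *)
Record greedy_rule (V : finType) (E : {set {set V}}) := GreedyRule {
  order : {set edge E} -> seq (edge E);
  pick_color : {set edge E} -> edge E -> seq nat -> nat;
  order_perm : forall H, perm_eq (order H) (enum H);
  pick_color_in : forall H e A, A != [::] -> pick_color H e A \in A
}.

Definition available (V : finType) (E : {set {set V}}) (k : nat)
    (chi : edge E -> option nat) (e : edge E) : seq nat :=
  [seq c <- iota 0 k | [forall f, adjacent f e ==> (chi f != Some c)]].

Definition greedy_step (V : finType) (E : {set {set V}}) (g : greedy_rule E)
    (k : nat) (H : {set edge E}) (chi : edge E -> option nat) (e : edge E) :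
    edge E -> option nat :=
  let A := available k chi e in
  fun f => if f == e then (if A is [::] then None else Some (pick_color g H e A))
           else chi f.

Definition greedy (V : finType) (E : {set {set V}}) (g : greedy_rule E)
    (k : nat) (H : {set edge E}) : edge E -> option nat :=
  foldl (greedy_step g k H) (fun=> None) (order g H).

(** * StaticColor *)

Definition Delta' (R : realType) (eps Delta : R) : R :=
  Delta `^ (30 * (nrounds eps)%:R)^-1.

Definition nparts (R : realType) (eps Delta : R) : nat :=
  nceil (Delta / Delta' eps Delta).

Definition part_bound (R : realType) (eps Delta : R) : R :=
  (1 + eps) * Delta' eps Delta.

(* The part of each edge of G, and one independent seed for each of the runs of
   Nibble. *)
Definition static_seed (R : realType) (V : finType) (E : {set {set V}})
    (eps Delta : R) : finType :=
  ({ffun edge E -> 'I_(nparts eps Delta)}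
   * {ffun 'I_(nparts eps Delta) ->
             nibble_seed E eps (part_bound eps Delta)})%type.

Definition static_pmf (R : realType) (V : finType) (E : {set {set V}})
    (eps Delta : R) : static_seed E eps Delta -> R :=
  prod_pmf (iid_pmf (@uniform_pmf R _)) (iid_pmf (@nibble_pmf R V E eps _)).

Definition subgraph (R : realType) (V : finType) (E : {set {set V}})
    (eps Delta : R) (omega : static_seed E eps Delta)
    (j : 'I_(nparts eps Delta)) : {set edge E} :=
  [set e | omega.1 e == j].

Definition all_failed (R : realType) (V : finType) (E : {set {set V}})
    (eps Delta : R) (omega : static_seed E eps Delta) : {set edge E} :=
  \bigcup_(j : 'I_(nparts eps Delta))
     nibble_failed (subgraph omega j) (omega.2 j).

(* With q the common size of the palettes of the runs and eta their number, the
   j-th run of Nibble owns the colors j * q, ..., j * q + q - 1, and the greedy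
   phase the colors from eta * q on. *)
Definition static_color (R : realType) (V : finType) (E : {set {set V}})
    (eps Delta : R) (g : greedy_rule E) (omega : static_seed E eps Delta)
    (e : edge E) : option nat :=
  let q := palette_size eps (part_bound eps Delta) in
  let H := all_failed omega in
  if e \in H then
    omap (fun c => nparts eps Delta * q + c)%N
         (greedy g (3 * max_degree H) H e)
  else
    let j := omega.1 e in
    omap (fun c : 'I_q => j * q + c)%N
         (tentative (subgraph omega j) (omega.2 j) e).

(* Main.v *)
Require Import Defs.
From HB Require Import structures.
From mathcomp Require Import all_boot all_order all_fingroup all_algebra.
From mathcomp Require Import reals sequences(expR) exp.
From mathcomp Require Import ring lra zify.

Set Implicit Arguments.
Unset Strict Implicit.
Unset Printing Implicit Defensive.
Import Order.TTheory GRing.Theory Num.Theory.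
Local Open Scope ring_scope.

(* Say that a part is bad at u if it contains a cycle of length at most 2T + 2
   through u.  Three events spoil the coloring: some part has a vertex of degree
   more than D = (1 + eps) Delta'; more than eps eta / 2 parts are bad at some u;
   at some u, more than 17 eps Delta edges fail in the parts that are not bad
   at u.  The first is excluded by a Chernoff bound.  For the second, cycles in
   distinct parts are disjoint, so they occur independently and the number of
   bad parts has an exponential moment.  Outside these events the failed edges
   have maximum degree O(eps Delta), with room for the greedy colors.

   For the third event, the parts are independent given the partition, and an
   exponential moment reduces the claim to the failure probability of an edge
   e = {u, v} of a part H that is not bad at u.  Then H \ e contains no short
   path from u to v, so that the runs of Nibble around u and around v use
   disjoint sets of seeds.  Permuting the colors in the seeds on the side of v
   preserves the distribution, fixes the palette of u and permutes the palette
   of v.  Transpositions show that e agrees with a given edge of its round at u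
   with probability at most the inverse of the size of the palette of u;
   summed over these edges this is at most eps.  A uniformly random permutation,
   with Chebyshev's inequality, shows that the two palettes have about
   eps^2 D or more common colors, so that the K tries of e fail with probability
   O(eps). *)

(** * Finite probability *)

Section FiniteProbability.
Variable R : realType.

Definition pmf (A : finType) (w : A -> R) : Prop :=
  (forall a, 0 <= w a) /\ \sum_a w a = 1.

Definition expect (A : finType) (w : A -> R) (F : A -> R) : R :=
  \sum_a w a * F a.

Section Expectation.
Variables (A : finType) (w : A -> R).

Lemma eq_expect (F G : A -> R) : F =1 G -> expect w F = expect w G.
Proof. by move=> FG; apply: eq_bigr => a _; rewrite FG. Qed.

Lemma prob_expect (P : pred A) : prob w P = expect w (fun a => (P a)%:R).
Proof.
by rewrite /prob /expect big_mkcond; apply: eq_bigr => a _; case: (P a);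
  rewrite ?mulr1 ?mulr0.
Qed.

Lemma expect_sum (I : Type) (r : seq I) (P : pred I) (F : I -> A -> R) :
  expect w (fun a => \sum_(i <- r | P i) F i a) =
  \sum_(i <- r | P i) expect w (F i).
Proof. by rewrite exchange_big; apply: eq_bigr => a _; rewrite mulr_sumr. Qed.

Lemma expectD (F G : A -> R) :
  expect w (fun a => F a + G a) = expect w F + expect w G.
Proof. by rewrite -big_split; apply: eq_bigr => a _; rewrite mulrDr. Qed.

Lemma expectZ (c : R) (F : A -> R) :
  expect w (fun a => c * F a) = c * expect w F.
Proof. by rewrite mulr_sumr; apply: eq_bigr => a _; rewrite mulrCA. Qed.

Hypothesis w_pmf : pmf w.

Lemma expect_cst (c : R) : expect w (fun=> c) = c.
Proof. by rewrite /expect -mulr_suml w_pmf.2 mul1r. Qed.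

Lemma ler_expect (F G : A -> R) :
  (forall a, F a <= G a) -> expect w F <= expect w G.
Proof. by move=> FG; apply: ler_sum => a _; rewrite ler_wpM2l ?w_pmf.1. Qed.

Lemma expect_ge0 (F : A -> R) : (forall a, 0 <= F a) -> 0 <= expect w F.
Proof. by move=> F0; apply: sumr_ge0 => a _; rewrite mulr_ge0 ?w_pmf.1. Qed.

Lemma prob_le1 (P : pred A) : prob w P <= 1.
Proof.
rewrite prob_expect -[leRHS](expect_cst 1).
by apply: ler_expect => a; rewrite lern1 leq_b1.
Qed.

Lemma prob_compl (P : pred A) : prob w P = 1 - prob w (predC P).
Proof. by rewrite /prob -w_pmf.2 (bigID P predT) /= addrK. Qed.

Lemma prob_sub (P Q : pred A) : (forall a, P a -> Q a) -> prob w P <= prob w Q.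
Proof.
move=> PQ; rewrite !prob_expect; apply: ler_expect => a.
by case: (P a) (PQ a) => // ->.
Qed.

Lemma prob_exists (I : finType) (P : I -> pred A) :
  prob w (fun a => [exists i, P i a]) <= \sum_i prob w (P i).
Proof.
rewrite (eq_bigr _ (fun i _ => prob_expect (P i))) -expect_sum prob_expect.
apply: ler_expect => a; case: existsP => [[i Pi]|_]; last by rewrite sumr_ge0.
by rewrite (bigD1 i) //= Pi lerDl sumr_ge0.
Qed.

Lemma prob_markov (P : pred A) (F : A -> R) :
  (forall a, 0 <= F a) -> (forall a, P a -> 1 <= F a) ->
  prob w P <= expect w F.
Proof.
move=> F0 PF; rewrite prob_expect; apply: ler_expect => a.
by case: (boolP (P a)) => [/PF|].
Qed.

Lemma expect_bij (h : A -> A) (F : A -> R) :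
  bijective h -> (forall a, w (h a) = w a) ->
  expect w (fun a => F (h a)) = expect w F.
Proof.
move=> hb hw; rewrite /expect [RHS](reindex h) /=; last exact: onW_bij.
by apply: eq_bigr => a _; rewrite hw.
Qed.

End Expectation.

Lemma uniform_pmfP (A : finType) : (0 < #|A|)%N -> pmf (@uniform_pmf R A).
Proof.
move=> A0; split=> [a|]; first by rewrite /uniform_pmf invr_ge0 ler0n.
by rewrite sumr_const -[LHS]mulr_natl divff // pnatr_eq0 -lt0n.
Qed.

Lemma prod_pmfP (A B : finType) (p : A -> R) (q : B -> R) :
  pmf p -> pmf q -> pmf (prod_pmf p q).
Proof.
move=> [p0 p1] [q0 q1]; split=> [a|]; first by rewrite mulr_ge0.
rewrite -(pair_bigA _ (fun a b => p a * q b)) /= -p1.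
by apply: eq_bigr => a _; rewrite -mulr_sumr q1 mulr1.
Qed.

Lemma expect_pair (A B : finType) (p : A -> R) (q : B -> R) (F : A * B -> R) :
  expect (prod_pmf p q) F = expect p (fun a => expect q (fun b => F (a, b))).
Proof.
transitivity (\sum_a \sum_b p a * q b * F (a, b)).
  by rewrite pair_bigA; apply: eq_bigr => [[a b]].
apply: eq_bigr => a _; rewrite mulr_sumr; apply: eq_bigr => b _.
by rewrite mulrA.
Qed.

Section Independent.
Variables (I A : finType) (p : A -> R).

Lemma expect_iid_prod (F : I -> A -> R) :
  expect (iid_pmf p) (fun x : {ffun I -> A} => \prod_i F i (x i)) =
  \prod_i expect p (F i).
Proof.
rewrite bigA_distr_bigA; apply: eq_bigr => x _.
by rewrite /iid_pmf -big_split.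
Qed.

Lemma iid_pmfP : pmf p -> pmf (@iid_pmf R I A p).
Proof.
move=> [p0 p1]; split=> [x|]; first exact: prodr_ge0.
by rewrite -(bigA_distr_bigA (fun _ a => p a)) big1.
Qed.

(** Over an empty index set there is a single function, of mass 1 whatever [p] is. This serves
    graphs without edges, where the set of colors may be empty and [uniform_pmf] no mass
    function. *)
Lemma iid_pmf0P : #|I| = 0 -> pmf (@iid_pmf R I A p).
Proof.
move=> I0; have iid1 x : @iid_pmf R I A p x = 1.
  by rewrite /iid_pmf big1 // => i; have := fintype0 i I0.
split=> [x|]; first by rewrite iid1.
have -> : \sum_x @iid_pmf R I A p x = #|{ffun I -> A}|%:R.
  by rewrite (eq_bigr _ (fun x _ => iid1 x)) sumr_const.
by rewrite card_ffun I0 expn0.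
Qed.

Definition upd (x : {ffun I -> A}) (i : I) (a : A) : {ffun I -> A} :=
  [ffun j => if j == i then a else x j].

Lemma updE x i a j : upd x i a j = if j == i then a else x j.
Proof. by rewrite ffunE. Qed.

Lemma upd_eq x i a : upd x i a i = a.
Proof. by rewrite updE eqxx. Qed.

Lemma upd_neq x i a j : j != i -> upd x i a j = x j.
Proof. by rewrite updE => /negPf ->. Qed.

(** Swapping coordinate [i] with the fresh value is an involution that preserves the product
    measure. *)
Lemma expect_resample (i : I) (F : {ffun I -> A} -> R) :
  pmf p ->
  expect (iid_pmf p) F =
  expect (iid_pmf p) (fun x => expect p (fun a => F (upd x i a))).
Proof.
move=> pP; rewrite -(expect_pair _ _ (fun xa => F (upd xa.1 i xa.2))).
pose h (xa : {ffun I -> A} * A) := (upd xa.1 i xa.2, xa.1 i).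
have hK : involutive h.
  move=> [x a]; rewrite /h /= updE eqxx; congr pair.
  by apply/ffunP => j; rewrite !updE; case: eqP => [->|].
have hw xa : prod_pmf (iid_pmf p) p (h xa) = prod_pmf (iid_pmf p) p xa.
  case: xa => x a; rewrite /prod_pmf /iid_pmf.
  rewrite (bigD1 i) // [in RHS](bigD1 i) //= updE eqxx mulrAC [p a * _]mulrC.
  rewrite [in RHS]mulrAC; congr (_ * _ * _).
  by apply: eq_bigr => j /negPf ji; rewrite updE ji.
rewrite -(expect_bij _ _ hw); last by exists h.
rewrite expect_pair; apply: eq_expect => x.
rewrite -[LHS](expect_cst pP); apply: eq_expect => a /=.
congr F.
by apply/ffunP => j; rewrite !updE; case: eqP => [->|].
Qed.

End Independent.

End FiniteProbability.

(** * Structure of a run of Nibble *)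

Section NibbleRun.
Variables (R : realType) (V : finType) (E : {set {set V}}) (eps D : R).
Variable H : {set edge E}.
Local Notation color := 'I_(palette_size eps D).
Local Notation seed := (nibble_seed E eps D).
Implicit Types (s : seed) (e f g : edge E) (x y u v w : V).

Definition palette s i u : {set color} :=
  vertex_palette H s (tentative_upto H s i) i u.

Lemma palette_in s i u c : (c \in palette s i u) =
  [forall f in H, incident u f && (round_of s f < i)%N ==>
                  (tentative_upto H s i f != Some c)].
Proof. by rewrite inE. Qed.

Lemma edge_palette_in s chi i e (c : color) : (c \in edge_palette H s chi i e) =
  [forall u, incident u e ==> (c \in vertex_palette H s chi i u)].
Proof.
apply/bigcapP/forallP => [h u|h u ue]; first by apply/implyP/h.
by move/implyP: (h u); apply.
Qed.

Lemma edge_palette2 s i u v e : val e = [set u; v] ->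
  edge_palette H s (tentative_upto H s i) i e = palette s i u :&: palette s i v.
Proof.
move=> ev; apply/setP => c; rewrite edge_palette_in in_setI.
apply/forallP/andP => [h|[hu hv] w].
  by split; [move/implyP: (h u) | move/implyP: (h v)]; apply;
    rewrite /incident ev !inE eqxx ?orbT.
by apply/implyP; rewrite /incident ev in_set2 => /orP[] /eqP ->.
Qed.

Lemma tentative_upto_late s m e :
  (m <= round_of s e)%N -> tentative_upto H s m e = None.
Proof.
elim: m => //= m IH me; rewrite ifF ?IH ?(ltnW me) //.
by rewrite (gtn_eqF me) andbF.
Qed.

Lemma tentative_upto_stable s m n e : (round_of s e < m <= n)%N ->
  tentative_upto H s n e = tentative_upto H s m e.
Proof.
case/andP=> em; elim: n => [|n IH]; first by rewrite leqn0 => /eqP ->.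
rewrite leq_eqVlt => /orP[/eqP -> //|mn] /=.
by rewrite ifF ?IH // (ltn_eqF (leq_trans em _)) ?andbF.
Qed.

Lemma tentative_uptoE s m e : e \in H -> (round_of s e < m)%N ->
  tentative_upto H s m e =
  first_color s e (edge_palette H s (tentative_upto H s (round_of s e))
                     (round_of s e) e).
Proof.
move=> eH em; rewrite (@tentative_upto_stable _ (round_of s e).+1) ?ltnSn //=.
by rewrite eH eqxx.
Qed.

Lemma tentativeE s e u v : e \in H -> (round_of s e < nrounds eps)%N ->
  val e = [set u; v] ->
  tentative H s e =
  first_color s e (palette s (round_of s e) u :&: palette s (round_of s e) v).
Proof.
by move=> eH eT ev; rewrite /tentative tentative_uptoE
  // (edge_palette2 _ _ ev).
Qed.

Lemma first_color_some s e P c : first_color s e P = Some c ->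
  (c \in P) /\ exists l, (s e).2 l = c.
Proof.
rewrite /first_color; set r := filter _ _ => rc.
have : c \in r by move: rc; case: r => // a r [->]; rewrite mem_head.
by rewrite mem_filter => /andP[-> /mapP[l _ ->]]; split; last by exists l.
Qed.

Lemma first_color_none s e P :
  (first_color s e P == None) = [forall l, (s e).2 l \notin P].
Proof.
rewrite /first_color; set r := filter _ _.
have -> : (ohead r == None) = (r == [::]) by case: r.
rewrite -[r == [::]]negbK -has_filter -all_predC all_map.
apply/allP/forallP => [h l|h l _]; last exact: h.
by apply: h; rewrite mem_enum.
Qed.

Lemma palette_sub s i u c f : f \in H -> incident u f ->
  (round_of s f < i)%N -> c \in palette s i u ->
  tentative_upto H s i f != Some c.
Proof.
move=> fH uf fi; rewrite palette_in => /forallP/(_ f)/implyP/(_ fH)/implyP.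
by rewrite uf fi; apply.
Qed.

Lemma tentative_palette s e u c : e \in H -> incident u e ->
  (round_of s e < nrounds eps)%N ->
  tentative H s e = Some c -> c \in palette s (round_of s e) u.
Proof.
move=> eH ue eT; rewrite /tentative tentative_uptoE // =>
  /first_color_some[+ _].
by rewrite edge_palette_in => /forallP/(_ u); rewrite ue.
Qed.

(** The later edge [e] draws from the palettes of its ends, and the color of [f] has left the
    palette of the common end. *)
Lemma tentative_lt s e f c : e \in H -> f \in H -> adjacent e f ->
  (round_of s f < round_of s e < nrounds eps)%N ->
  tentative H s e = Some c -> tentative H s f != Some c.
Proof.
move=> eH fH /andP[_ /existsP[u /andP[ue uf]]] /andP[fe eT] ec.
rewrite /tentative (@tentative_upto_stable _ (round_of s e)) ?fe ?(ltnW eT) //.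
exact: palette_sub (tentative_palette eH ue eT ec).
Qed.

(** In different rounds the palettes keep the colors apart; in the same round, equal colors would
    have made the edges fail. *)
Lemma nibble_failedN_inj s e f : e \in H -> f \in H -> adjacent e f ->
  e \notin nibble_failed H s -> f \notin nibble_failed H s ->
  [/\ tentative H s e != None, tentative H s f != None &
      tentative H s e != tentative H s f].
Proof.
move=> eH fH ef.
rewrite !inE eH fH /= !negb_or => /and3P[eT eN eC] /and3P[fT fN fC].
split=> //.
have lt g : round_of s g != nrounds eps -> (round_of s g < nrounds eps)%N.
  by move=> gT; rewrite ltn_neqAle gT -ltnS ltn_ord.
case: (ltngtP (round_of s e) (round_of s f)) => [l|l|l].
- case Hf: (tentative H s f) fN => [c|//] _.
  apply: (@tentative_lt _ f) => //; last by rewrite l lt.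
  by rewrite /adjacent eq_sym; case/andP: ef => -> /existsP[u ?];
     apply/existsP; exists u; rewrite andbC.
- case He: (tentative H s e) eN => [c|//] _; rewrite eq_sym.
  by apply: (@tentative_lt _ e) => //; rewrite l lt.
- move/existsP: fC => nex; apply/eqP => C; case: nex; exists e.
  by rewrite eH ef l C !eqxx.
Qed.

(** * Recoloring of seeds and locality of the process *)

Definition recolor (tau : edge E -> {perm color}) s : seed :=
  [ffun g => ((s g).1, [ffun l => tau g ((s g).2 l)])].

Lemma round_recolor tau s g : round_of (recolor tau s) g = round_of s g.
Proof. by rewrite /round_of ffunE. Qed.

Lemma recolor_bij tau : bijective (recolor tau).
Proof.
exists (recolor (fun g => (tau g)^-1)%g) => s; apply/ffunP => g;
  rewrite !ffunE /=;
  case: (s g) => a b /=; congr pair; apply/ffunP => l; rewrite !ffunE.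
  by rewrite permK.
by rewrite permKV.
Qed.

(** The tries are uniform, so the mass of a seed depends on its rounds only. *)
Lemma nibble_pmf_recolor tau s : nibble_pmf (recolor tau s) = nibble_pmf s.
Proof. by apply: eq_bigr => g _; rewrite ffunE. Qed.

Lemma first_color_recolor (tau : edge E -> {perm color}) s g (P P' : {set
  color}) :
  (forall c, (tau g c \in P') = (c \in P)) ->
  first_color (recolor tau s) g P' = omap (tau g) (first_color s g P).
Proof.
move=> PP'; rewrite /first_color ffunE /=.
have -> : [seq [ffun l => tau g ((s g).2 l)] l | l <- enum 'I_(ntries eps)] =
          map (tau g) [seq (s g).2 l | l <- enum 'I_(ntries eps)].
  by rewrite -[RHS]map_comp; apply/eq_in_map => l _; rewrite /= ffunE.
move: [seq (s g).2 l | l <- _] => r.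
rewrite filter_map (@eq_filter _ _ (fun c => c \in P)) //.
by case: (filter _ _).
Qed.

Definition touches (S : {set V}) g := [exists y in S, incident y g].

(** The ball of radius [r] in the graph metric of [F]. Influence travels one step per round, so the
    palette of [x] in round [i] reads only seeds of edges that touch the ball of radius [i]. *)
Fixpoint ball (F : {set edge E}) x r : {set V} :=
  if r is r'.+1 then
    [set w | (w \in ball F x r') ||
             [exists g in F, incident w g && touches (ball F x r') g]]
  else [set x].

Lemma ball_sub F x r r' : (r <= r')%N -> ball F x r \subset ball F x r'.
Proof.
elim: r' => [|r' IH]; first by rewrite leqn0 => /eqP ->.
rewrite leq_eqVlt => /orP[/eqP -> //|/IH] h.
by apply: subset_trans h _; apply/subsetP => w wB; rewrite inE wB.
Qed.

Lemma ball_step (F : {set edge E}) x r w y g : g \in F -> y \in ball F x r ->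
  incident y g ->
  incident w g -> w \in ball F x r.+1.
Proof.
move=> gF yB yg wg; rewrite inE; apply/orP; right.
apply/existsP; exists g; rewrite gF wg; apply/existsP; exists y.
by rewrite yB yg.
Qed.

Section Equivariance.
Variables (s : seed) (e : edge E) (x : V) (N : nat) (pi : {perm color}).
Variable tau : edge E -> {perm color}.
Hypothesis tau_pi :
  forall g, g \in H :\ e -> touches (ball (H :\ e) x N) g -> tau g = pi.

(** Induction on [m]: a color given in one round reads the colors of adjacent edges from the rounds
    before, which costs one unit of radius; hence the sum [r + m]. The edges read have a round
    before that of [e], so [e] is never among them and the balls may be taken in [H :\ e]. *)
Lemma tentative_upto_recolor m r g y : (r + m <= N)%N ->
  (m <= (round_of s e).+1)%N -> g \in H :\ e ->
  y \in ball (H :\ e) x r -> incident y g ->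
  tentative_upto H (recolor tau s) m g = omap pi (tentative_upto H s m g).
Proof.
elim: m r g y => [//|m IH] r g y rm me gH yr yg /=.
have gHe : g \in H by move: gH; rewrite !inE => /andP[].
rewrite round_recolor gHe /=; case: ifP => gm; last first.
  by apply: (IH r _ y) => //; [rewrite addnS in rm; exact: ltnW | exact: ltnW].
have taug : tau g = pi.
  apply: tau_pi => //; apply/existsP; exists y; rewrite yg andbT.
  by apply: (subsetP (ball_sub _ _ (leq_trans (leq_addr _ _) rm))).
rewrite (@first_color_recolor _ _ _ (edge_palette H s (tentative_upto H s m) m
  g)).
  by rewrite taug.
move=> c; rewrite taug !edge_palette_in; apply: eq_forallb => w.
case: (boolP (incident w g)) => //= wg.
rewrite !inE; apply: eq_forallb => f; case: (boolP (f \in H)) => //= fH.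
rewrite round_recolor; case: (boolP (incident w f)) => //= wf.
case: (ltnP (round_of s f) m) => //= fm.
have fHe : f \in H :\ e.
  rewrite !inE fH andbT; apply: contraTneq fm => ->.
  by rewrite -leqNgt -ltnS.
rewrite (IH r.+1 f w) ?addSnnS // ?(ltnW me) //;
  last exact: ball_step gH yr yg wg.
case: (tentative_upto H s m f) => //= a.
by rewrite (inj_eq Some_inj) (inj_eq (@perm_inj _ pi)).
Qed.

Lemma palette_recolor i c : (i <= N)%N -> (i <= round_of s e)%N ->
  (pi c \in palette (recolor tau s) i x) = (c \in palette s i x).
Proof.
move=> iN ie; rewrite !palette_in; apply: eq_forallb => f.
case: (boolP (f \in H)) => //= fH.
rewrite round_recolor; case: (boolP (incident x f)) => //= xf.
case: (ltnP (round_of s f) i) => //= fi.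
have fHe : f \in H :\ e.
  by rewrite !inE fH andbT; apply: contraTneq fi => ->; rewrite -leqNgt.
rewrite (@tentative_upto_recolor _ 0 _ x) ?add0n ?(leqW ie) ?set11 //.
case: (tentative_upto H s i f) => //= a.
by rewrite (inj_eq Some_inj) (inj_eq (@perm_inj _ pi)).
Qed.

Lemma tentative_recolor f : f \in H :\ e -> incident x f ->
  (round_of s f <= round_of s e)%N -> (round_of s f < N)%N ->
  (round_of s f < nrounds eps)%N ->
  tentative H (recolor tau s) f = omap pi (tentative H s f).
Proof.
move=> fH xf fe fN fT.
rewrite /tentative !(@tentative_upto_stable _ (round_of s f).+1) ?round_recolor
  ?ltnSn //.
by apply: (@tentative_upto_recolor _ 0 _ x); rewrite ?set11.
Qed.

End Equivariance.

End NibbleRun.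

(** * The failure probability of an edge *)

Section RoundDistribution.
Variables (R : realType) (eps : R).
Hypothesis eps01 : 0 < eps < 1.
Local Notation T := (nrounds eps).

(** The last class carries all the mass that the geometric law leaves from [T] on, so the sum
    telescopes. *)
Lemma round_pmf_ge i : (i <= T)%N ->
  \sum_(a : 'I_T.+1 | (i <= a)%N) round_pmf a = (1 - eps) ^+ i.
Proof.
move=> iT; rewrite big_mkcond /=.
pose F (a : nat) : R := if (i <= a)%N then
  (if (a < T)%N then (1 - eps) ^+ a * eps else (1 - eps) ^+ T) else 0.
rewrite (eq_bigr (fun a : 'I_T.+1 => F a)) //.
rewrite big_ord_recr /= {2}/F ltnn iT.
have -> : \sum_(a < T) F a = \sum_(a < T) (if (i <=
  a)%N then (1 - eps) ^+ a * eps else 0).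
  by apply: eq_bigr => a _; rewrite /F ltn_ord.
elim: T iT => [|t IH]; first by rewrite leqn0 => /eqP ->;
  rewrite big_ord0 add0r.
rewrite leq_eqVlt => /orP[/eqP ->|it].
  rewrite big1 ?add0r // => a _; by rewrite ifF // leqNgt ltn_ord.
by rewrite big_ord_recr /= -ltnS it -(IH it) exprS; ring.
Qed.

Lemma round_pmf_ge0 (a : 'I_T.+1) : 0 <= round_pmf a.
Proof.
have /andP[e0 e1] := eps01; have h : 0 <= 1 - eps by lra.
rewrite /round_pmf.
by case: ifP => _; rewrite ?mulr_ge0 ?exprn_ge0 //; lra.
Qed.

Lemma round_pmfP : pmf (@round_pmf R eps).
Proof.
split; first exact: round_pmf_ge0.
by have := round_pmf_ge (leq0n _); rewrite expr0.
Qed.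

(** Memorylessness: given that a round is not before [a], it equals [a] with probability [eps]. The
    last class is excluded because it takes all the remaining mass. *)
Lemma round_pmf_hazard (a : 'I_T.+1) : (a < T)%N ->
  round_pmf a = eps * \sum_(b : 'I_T.+1 | (a <= b)%N) round_pmf b.
Proof. by move=> aT; rewrite round_pmf_ge 1?ltnW // mulrC /round_pmf aT. Qed.

End RoundDistribution.

Lemma expect_coord (R : realType) (I A : finType) (p : A -> R) (i : I)
    (F : A -> R) :
  pmf p -> expect (iid_pmf p) (fun x : {ffun I -> A} => F (x i)) = expect p F.
Proof.
move=> pP; rewrite (expect_resample i _ pP).
under eq_expect => x do under eq_expect => a do rewrite updE eqxx.
by rewrite expect_cst //; exact: iid_pmfP.
Qed.

Section EdgeFailure.
Variables (R : realType) (V : finType) (E : {set {set V}}) (eps D : R).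
Variable H : {set edge E}.
Local Notation T := (nrounds eps).
Local Notation q := (palette_size eps D).
Local Notation color := 'I_q.
Local Notation seed := (nibble_seed E eps D).
Local Notation entry := ('I_T.+1 * {ffun 'I_(ntries eps) -> color})%type.
Local Notation w := (@nibble_pmf R V E eps D).
Implicit Types (s : seed) (e f g : edge E) (x y u v : V).

Hypothesis eps01 : 0 < eps < 1.
Hypothesis q_gt0 : (0 < q)%N.

Lemma seed_entry_pmfP :
  pmf (prod_pmf (@round_pmf R eps)
        (iid_pmf (@uniform_pmf R color) : {ffun 'I_(ntries eps) -> color} ->
          R)).
Proof.
apply: prod_pmfP; first exact: round_pmfP.
by apply/iid_pmfP/uniform_pmfP; rewrite card_ord.
Qed.

Lemma nibble_pmfP : pmf w.
Proof. exact: iid_pmfP seed_entry_pmfP. Qed.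

(** Each color missing from the palette is the tentative color of an edge at [x] of an earlier
    round. *)
Lemma card_palette s i x :
  (q <= #|palette H s i x| +
        #|[set g in H | incident x g & (round_of s g < i)%N]|)%N.
Proof.
set S := [set g in H | _].
suff : (#|~: palette H s i x| <= #|S|)%N.
  by rewrite cardsCs setCK card_ord leq_subLR.
rewrite -(card_imset (mem (~: palette H s i x)) Some_inj).
apply: leq_trans (leq_imset_card (tentative_upto H s i) (mem S)).
apply/subset_leq_card/subsetP => _ /imsetP[c + ->].
rewrite inE palette_in negb_forall => /existsP[g].
rewrite negb_imply => /andP[gH]; rewrite negb_imply negbK => /andP[xg /eqP gc].
by apply/imsetP; exists g; rewrite ?inE ?gH.
Qed.

Section Edge.
Variables (e : edge E) (u v : V).
Hypothesis eH : e \in H.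
Hypothesis e_uv : val e = [set u; v].
(** The absence of short cycles through [e], in the form used: within [T] rounds no other edge
    influences both ends of [e]. *)
Hypothesis e_tree : forall g, g \in H :\ e ->
  ~~ (touches (ball (H :\ e) u T) g && touches (ball (H :\ e) v T) g).
Hypothesis deg_u : (#|[set g in H | incident u g]| <= q)%N.

Local Notation Pal s x := (palette H s (round_of s e) x).

Let vN (g : edge E) := touches (ball (H :\ e) v T) g.

(** The edge [e] is recolored together with the side of [v], so that its color moves while the
    palette of [u] stays. *)
Definition side_edge_tau (pi : {perm color}) : edge E -> {perm color} :=
  fun g => if (g == e) || vN g then pi else 1%g.

(** These edges compete with [e] at [u]. Their number bounds the palette of [u] from below and,
    unlike the palette, depends on the rounds only. *)
Definition later s : {set edge E} :=
  [set g in H :\ e | incident u g & (round_of s e <= round_of s g)%N].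

Lemma in_later s g : (g \in later s) =
  [&& g \in H :\ e, incident u g & (round_of s e <= round_of s g)%N].
Proof. by rewrite in_set. Qed.

Lemma round_upd s f (a : entry) g :
  round_of (upd s f a : seed) g = if g == f then a.1 : nat else round_of s g.
Proof. by rewrite /round_of updE; case: eqP. Qed.

(** The right-hand side does not mention [a]: moving [f] to any round not before that of [e] gives
    the same count. *)
Lemma card_later_upd s f (a : entry) : f != e -> (round_of s e <= a.1)%N ->
  #|later (upd s f a : seed)| =
  #|[set g | if g == f then (f \in H :\ e) && incident u f else g \in later s]|.
Proof.
rewrite eq_sym => /negPf ef ea; apply: eq_card => g.
rewrite in_later in_set (round_upd s f a e) (round_upd s f a g) ef.
by case: (eqVneq g f) => [->|gf]; rewrite ?ea ?andbT // in_later.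
Qed.

(** There are at most [q] edges at [u]. Those of earlier rounds remove at most one color each, and
    the colors that remain suffice for the others. *)
Lemma later_le_palette s : (#|later s| <= #|Pal s u|)%N.
Proof.
have := card_palette s (round_of s e) u.
move: deg_u; set A := [set g in H | incident u g].
set B := [set g in H | _ & _]; move=> Aq qB.
suff : (#|later s| + #|B| <= #|A|)%N by lia.
have dis : [disjoint later s & B].
  rewrite -setI_eq0; apply/eqP/setP => g; rewrite !inE.
  by case: leqP; rewrite ?andbF.
rewrite -(leq_card_setU (later s) B).2 in dis.
rewrite -(eqP dis); apply/subset_leq_card/subsetP => g; rewrite !inE.
by case/orP => [/and3P[/andP[_ ->] ->]|/and3P[-> ->]].
Qed.

(** By [e_tree] the edges near [u] are away from [v], so near [u] the recoloring is the identity. *)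
Lemma Pal_u_recolor (tau : edge E -> {perm color}) s c : (round_of s e < T)%N ->
  (forall g, g \in H :\ e -> vN g = false -> tau g = 1%g) ->
  (c \in Pal (recolor tau s) u) = (c \in Pal s u).
Proof.
move=> eT tau1; rewrite round_recolor.
rewrite -{1}[c](perm1 c).
apply: (@palette_recolor _ _ _ _ _ _ _ e _ T) => // [g gH gu|];
  last exact: ltnW.
by apply: tau1 => //; move: (e_tree gH); rewrite gu => /negPf.
Qed.

Lemma Pal_v_recolor (tau : edge E -> {perm color}) (pi : {perm color}) s c :
  (round_of s e < T)%N ->
  (forall g, g \in H :\ e -> vN g -> tau g = pi) ->
  (pi c \in Pal (recolor tau s) v) = (c \in Pal s v).
Proof.
move=> eT taupi; rewrite round_recolor.
by apply: (@palette_recolor _ _ _ _ _ _ _ e _ T) => //; exact: ltnW.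
Qed.

(** Agreement on [None] is left out; it belongs to the event that all tries of [e] fail. *)
Definition collision s f :=
  [&& round_of s f == round_of s e, (round_of s e < T)%N,
      tentative H s e != None & tentative H s f == tentative H s e].

(* Exchanging two colors c0 and c of the palette of u in the seeds of e and of
   the v-side leaves this palette and the color of f unchanged, and moves the
   color of e from c0 to c.  So, given the u-side, the color of f is no likelier
   for e than any other color of the palette. *)
Lemma collision_le_inv_palette f : f \in H :\ e -> incident u f ->
  prob w (collision ^~ f) <=
  expect w (fun s => ((round_of s f == round_of s e) &&
                      (round_of s e < T)%N)%:R / #|Pal s u|%:R).
Proof.
move=> fH uf.
have fHH : f \in H by move: fH; rewrite !inE => /andP[].
(* [L c0 c] spreads a collision in color [c0] evenly over the colors [c] of the palette of [u], and
   [G c0 c] has [e] on [c] instead. The sum of all [L] is at least the indicator of the collision;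
   the sum of all [G] is at most the inverse of the palette size. *)
pose L (c0 c : color) s : R :=
  ([&& collision s f, tentative H s f == Some c0 & c \in Pal s u])%:R / #|Pal
    s u|%:R.
pose G (c0 c : color) s : R :=
  ([&& round_of s f == round_of s e, (round_of s e < T)%N,
       tentative H s f == Some c0 & tentative H s e == Some c])%:R / #|Pal s
         u|%:R.
have ue : incident u e by rewrite /incident e_uv !inE eqxx.
have LG c0 c : expect w (L c0 c) <= expect w (G c0 c).
  pose tau := side_edge_tau (tperm c0 c).
  rewrite -(expect_bij (G c0 c) (@recolor_bij _ _ _ _ _ tau)
             (@nibble_pmf_recolor _ _ _ _ _ tau)).
  apply: ler_expect => [|s]; first exact: nibble_pmfP.
  rewrite /L; case: (boolP [&& _, _ & _]) => [|_]; last first.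
    by rewrite mul0r mulr_ge0 ?invr_ge0 ?ler0n.
  case/and3P=> /and4P[/eqP fe eT _ /eqP C] /eqP fc0 cP.
  have c0P : c0 \in Pal s u.
    by apply: (tentative_palette eH ue eT); rewrite -C.
  have PU c' : (c' \in Pal (recolor tau s) u) = (c' \in Pal s u).
    apply: Pal_u_recolor => // g; rewrite !inE => /andP[ge _] gv.
    by rewrite /tau /side_edge_tau (negPf ge) gv.
  rewrite /G (eq_card PU) !round_recolor fe eqxx eT /=.
  have -> : tentative H (recolor tau s) f = Some c0.
    rewrite (@tentative_recolor _ _ _ _ _ _ s e u T 1%g) ?fe ?fc0 //= ?perm1 //.
    move=> g gH gu; rewrite /tau /side_edge_tau; move: (e_tree gH).
    by rewrite gu /= -/(vN g) => /negPf ->; move: gH;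
      rewrite !inE => /andP[/negPf ->].
  have -> : tentative H (recolor tau s) e = Some c; last by rewrite !eqxx.
  rewrite (tentativeE eH _ e_uv) ?round_recolor //.
  rewrite (@first_color_recolor _ _ _ _ _ _ _ _ (Pal s u :&: Pal s v)).
    rewrite -(tentativeE eH eT e_uv) -C fc0 /= /tau /side_edge_tau eqxx /=.
    by rewrite tpermL.
  move=> c'; rewrite !in_setI -[in LHS](round_recolor tau s e) PU.
  rewrite {1 2}/tau /side_edge_tau eqxx /=; congr andb.
    by case: tpermP => // ->; rewrite ?c0P ?cP.
  apply: Pal_v_recolor => // g gH gv.
  by rewrite /tau /side_edge_tau gv orbT.
apply: (@le_trans _ _ (\sum_c0 \sum_c expect w (L c0 c))).
  rewrite prob_expect.
  under eq_bigr do rewrite -expect_sum.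
  rewrite -expect_sum; apply: ler_expect => [|s]; first exact: nibble_pmfP.
  case: (boolP (collision s f)) => [Cf|_]; last first.
    by apply: sumr_ge0 => c0 _; apply: sumr_ge0 => c _;
       rewrite mulr_ge0 ?invr_ge0 ?ler0n.
  have /and4P[fe eT eN /eqP C] := Cf.
  case He : (tentative H s e) eN => [c0|//] _.
  have c0P : c0 \in Pal s u by apply: (tentative_palette eH ue eT).
  rewrite (bigD1 c0) //= ler_wpDr //.
    by apply: sumr_ge0 => c1 _; apply: sumr_ge0 => c _;
       rewrite mulr_ge0 ?invr_ge0 ?ler0n.
  rewrite /L Cf C He eqxx /= -mulr_suml -natr_sum -sum1_card.
  rewrite [X in _ <= X / _](_ : _ = (\sum_(c in Pal s u) 1)%:R).
    rewrite divff // sum1_card pnatr_eq0 -lt0n; apply/card_gt0P.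
    by exists c0.
  by congr (_%:R); rewrite [RHS]big_mkcond /=; apply: eq_bigr => c _;
    case: (c \in _).
apply: (@le_trans _ _ (\sum_c0 \sum_c expect w (G c0 c))).
  by apply: ler_sum => c0 _; apply: ler_sum => c _.
under eq_bigr do rewrite -expect_sum.
rewrite -expect_sum; apply: ler_expect => [|s]; first exact: nibble_pmfP.
under eq_bigr do rewrite -mulr_suml.
rewrite -mulr_suml ler_wpM2r ?invr_ge0 ?ler0n //.
case: (boolP (_ && _)) => [/andP[-> ->] /=|]; last first.
  rewrite negb_and => h; rewrite big1 // => c0 _; rewrite big1 // => c _.
  by case/orP: h => /negPf ->; rewrite ?andbF.
case: (tentative H s f) => [a|]; last first.
  by rewrite big1 // => c0 _; rewrite big1.
rewrite (bigD1 a) //= [X in _ + X]big1 ?addr0; last first.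
  move=> c0 /negPf ca; rewrite big1 // => c _.
  by rewrite (inj_eq Some_inj) eq_sym ca.
rewrite eqxx; case: (tentative H s e) => [b|]; last by rewrite big1.
rewrite (bigD1 b) //= [X in _ + X]big1 ?addr0 ?eqxx //.
by move=> c /negPf cb; rewrite (inj_eq Some_inj) eq_sym cb.
Qed.

(* The palette of u has at least as many colors as there are edges of H :\ e at
   u that are not colored before the round of e; by the memoryless property of
   the rounds, each of these has the round of e with probability at most eps. *)
Lemma sum_collision_le :
  \sum_(f in H :\ e | incident u f) prob w (collision ^~ f) <= eps.
Proof.
pose W f s : R := ((round_of s e <= round_of s f)%N && (round_of s e < T)%N)%:R
                  / #|later s|%:R.
apply: (@le_trans _ _ (\sum_(f in H :\ e | incident u f) eps * expect w (W f))).
  apply: ler_sum => f /andP[fH uf].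
  apply: le_trans (collision_le_inv_palette fH uf) _.
  apply: (@le_trans _ _ (expect w (fun s =>
     ((round_of s f == round_of s e) && (round_of s e < T)%N)%:R / #|later
       s|%:R))).
    apply: ler_expect => [|s]; first exact: nibble_pmfP.
    case: (boolP (_ && _)) => [/andP[/eqP fe eT]|_]; last by rewrite !mul0r.
    have l0 : (0 < #|later s|)%N.
      by apply/card_gt0P; exists f; rewrite inE fH uf fe leqnn.
    rewrite !mul1r lef_pV2 ?posrE ?ltr0n ?ler_nat ?later_le_palette //.
    exact: leq_trans l0 (later_le_palette s).
  (* With all other seeds fixed, only the round of [f] matters in both expectations. *)
  rewrite (expect_resample f _ seed_entry_pmfP).
  rewrite [X in eps * X](expect_resample f _ seed_entry_pmfP) -expectZ.
  apply: ler_expect => [|s]; first exact: nibble_pmfP.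
  have fe : f != e by move: fH; rewrite !inE => /andP[].
  set i := round_of s e.
  have ri (a : entry) : round_of (upd s f a : seed) e = i.
    by rewrite round_upd eq_sym (negPf fe).
  have rf (a : entry) : round_of (upd s f a : seed) f =
    a.1 by rewrite round_upd eqxx.
  (* [k] is the value of the denominator for every round of [f] from [i] on. *)
  have [k lk] : exists k, forall a : entry,
      (i <= a.1)%N -> #|later (upd s f a : seed)| = k.
    by eexists => a ia; exact: card_later_upd.
  rewrite !expect_pair.
  case: (ltnP i T) => iT; last first.
    rewrite /expect !big1 ?mulr0 // => a _; rewrite big1 ?mulr0 // => b _;
      by rewrite /W ri ltnNge iT andbF mul0r mulr0.
  have uP : pmf (iid_pmf (@uniform_pmf R color)
                 : {ffun 'I_(ntries eps) -> color} -> R).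
    by apply/iid_pmfP/uniform_pmfP; rewrite card_ord.
  pose ii : 'I_T.+1 := (s e).1.
  have -> : expect (@round_pmf R eps) (fun a => expect (iid_pmf (@uniform_pmf
    R _)) (fun b =>
     ((round_of (upd s f (a, b)) f == round_of (upd s f (a, b)) e) &&
     (round_of (upd s f (a, b)) e < T)%N)%:R / #|later (upd s f (a, b))|%:R))
     = round_pmf ii / k%:R.
    rewrite -(expect_cst uP (round_pmf ii / k%:R)) /expect (bigD1 ii) //=.
    rewrite [X in _ + X]big1 ?addr0 => [|a ai].
      rewrite mulr_sumr; apply: eq_bigr => b _.
      by rewrite rf ri eqxx iT lk //= mul1r; ring.
    rewrite big1 ?mulr0 // => b _; rewrite rf ri /=.
    by rewrite (_ : (a : nat) == i = false) ?mul0r ?mulr0 //; exact: negPf.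
  have -> : expect (@round_pmf R eps) (fun a => expect (iid_pmf (@uniform_pmf
    R _)) (fun b =>
     W f (upd s f (a, b)))) = (\sum_(a : 'I_T.+1 | (i <=
       a)%N) round_pmf a) / k%:R.
    rewrite big_mkcond mulr_suml /expect; apply: eq_bigr => a _.
    case: ifP => ia.
      rewrite -[in RHS](expect_cst uP (round_pmf a / k%:R)) mulr_sumr.
      apply: eq_bigr => b _; rewrite /W rf ri ia iT lk //= mul1r; ring.
    by rewrite big1 ?mulr0 ?mul0r // => b _; rewrite /W rf ri ia mul0r mulr0.
  by rewrite (@round_pmf_hazard _ _ ii) // mulrA.
have /andP[e0 _] := eps01.
rewrite -mulr_sumr -[leRHS]mulr1 ler_wpM2l ?(ltW e0) //.
rewrite -expect_sum -[leRHS](expect_cst nibble_pmfP).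
apply: ler_expect => [|s]; first exact: nibble_pmfP.
rewrite -mulr_suml -natr_sum.
set S := (\sum_(_ | _) _)%N.
(* The numerators, summed over [f], count at most the edges of [later s], so the quotient is at most
   1. *)
have SL : (S <= #|later s|)%N.
  rewrite /S -sum1_card big_mkcond [leqRHS]big_mkcond /=; apply: leq_sum => g _.
  rewrite in_later; case: (_ \in _); case: (incident u g) => //=.
  by case: (round_of s e <= round_of s g)%N; case: (round_of s e < T)%N.
(* If [later s] is empty the quotient is 0, because the inverse of 0 is 0. *)
case: (posnP #|later s|) => [->|l0]; first by rewrite invr0 mulr0.
by rewrite ler_pdivrMr ?ltr0n // mul1r ler_nat.
Qed.

End Edge.
End EdgeFailure.

(** * Random permutations *)

Section RandomPermutation.
Variables (R : realType) (T : finType).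
Local Notation n := (#|T|%:R : R).
Local Notation N := (#|{perm T}|%:R : R).
Implicit Types (A B : {set T}) (a b : T) (pi : {perm T}).

Lemma sum_perm_mulr (F : {perm T} -> R) (tau : {perm T}) :
  \sum_(pi : {perm T}) F (pi * tau)%g = \sum_(pi : {perm T}) F pi.
Proof.
rewrite [RHS](reindex (fun pi => (pi * tau)%g)) //=; apply: onW_bij.
by exists (fun pi => (pi * tau^-1)%g) => pi; rewrite ?mulgK ?mulgKV.
Qed.

(** Composing with a transposition shows that the count is the same for all targets [a]; over all
    targets the counts add up to [N]. *)
Lemma sum_perm_move b a : (\sum_(pi : {perm T}) (pi b == a)%:R) * n = N.
Proof.
have same a' : \sum_(pi : {perm T}) (pi b == a')%:R =
  \sum_(pi : {perm T}) (pi b == a)%:R :> R.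
  rewrite -(sum_perm_mulr _ (tperm a a')); apply: eq_bigr => pi _.
  by rewrite permM -[X in _ == X](tpermL a a') (inj_eq perm_inj).
transitivity (\sum_a' \sum_(pi : {perm T}) (pi b == a')%:R : R).
  by rewrite (eq_bigr _ (fun a' _ => same a')) sumr_const mulr_natr.
rewrite exchange_big /= (eq_bigr (fun=> 1)) ?sumr_const // => pi _.
rewrite (bigD1 (pi b)) //= eqxx big1 ?addr0 // => a' /negPf.
by rewrite eq_sym => ->.
Qed.

(** The same averaging, over the [n * (n - 1)] ordered pairs of distinct targets. *)
Lemma sum_perm_move2 b b' a a' : b != b' -> a != a' ->
  (\sum_(pi : {perm T}) ((pi b == a) && (pi b' == a'))%:R) * (n * (n - 1)) = N.
Proof.
move=> bb' aa'.
have same c c' : c != c' ->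
    \sum_(pi : {perm T}) ((pi b == c) && (pi b' == c'))%:R =
    \sum_(pi : {perm T}) ((pi b == a) && (pi b' == a'))%:R :> R.
  (* The first transposition moves [a] to [c]; the second moves the image of [a'] to [c'] and fixes
     [c]. *)
  move=> cc'; pose tau := (tperm a c * tperm (tperm a c a') c')%g.
  have ta' : tau a' = c' by rewrite permM tpermL.
  have ta : tau a = c.
    rewrite permM tpermL tpermD //; last by rewrite eq_sym.
    by rewrite -[X in _ != X](tpermL a c) (inj_eq perm_inj) eq_sym.
  rewrite -(sum_perm_mulr _ tau); apply: eq_bigr => pi _.
  by rewrite (permM pi tau b) (permM pi tau b') -{1}ta -{1}ta' !(inj_eq
    perm_inj).
have n1 : n - 1 = (#|T|.-1)%:R.
  by rewrite -subn1 natrB //; apply/card_gt0P; exists b.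
transitivity (\sum_c \sum_(c' | c' != c)
                \sum_(pi : {perm T}) ((pi b == c) && (pi b' == c'))%:R : R).
  rewrite [RHS](eq_bigr (fun=> (n - 1) * \sum_(pi : {perm T}) ((pi b == a) &&
    (pi b' == a'))%:R)).
    by rewrite sumr_const -[RHS]mulr_natr; ring.
  move=> c _; rewrite (eq_bigr (fun=> \sum_(pi : {perm T}) ((pi b == a) && (pi
    b' == a'))%:R)).
    by rewrite sumr_const n1 mulr_natl; congr (_ *+ _); rewrite cardC1.
  by move=> c' cc'; apply: same; rewrite eq_sym.
under eq_bigr do rewrite exchange_big.
rewrite exchange_big /= (eq_bigr (fun=> 1)) ?sumr_const // => pi _.
rewrite (bigD1 (pi b)) //= [X in _ + X]big1 ?addr0; last first.
  by move=> c /negPf cb; rewrite big1 // => c' _; rewrite eq_sym cb.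
rewrite (bigD1 (pi b')) /=; last by rewrite (inj_eq perm_inj) eq_sym.
rewrite !eqxx big1 ?addr0 // => c' /andP[_ /negPf].
by rewrite eq_sym => ->.
Qed.

Lemma card_setI_perm A B pi :
  #|A :&: pi @: B|%:R = \sum_(a in A) \sum_(b in B) (pi b == a)%:R :> R.
Proof.
rewrite -sum1_card natr_sum (eq_bigl (fun a => (a \in A) && (a \in pi @: B)))
  => [|a]; last by rewrite inE.
rewrite big_mkcondr; apply: eq_bigr => a _; case: imsetP => [[b bB ->]|nB].
  rewrite (bigD1 b) //= eqxx big1 ?addr0 // => c /andP[_ /negPf cb].
  by rewrite (inj_eq perm_inj) cb.
by rewrite big1 // => b bB; case: eqP => // ba; case: nB; exists b.
Qed.

Lemma sum_perm_card A B : (\sum_(pi : {perm T}) #|A :&: pi @: B|%:R) * n =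
  N * #|A|%:R * #|B|%:R.
Proof.
under eq_bigr do rewrite card_setI_perm.
rewrite exchange_big mulr_suml (eq_bigr (fun=> #|B|%:R * N)).
  by rewrite sumr_const -[LHS]mulr_natr; ring.
move=> a _; rewrite exchange_big mulr_suml (eq_bigr (fun=> N)).
  by rewrite sumr_const mulr_natl.
by move=> b _; rewrite sum_perm_move.
Qed.

(** The square counts pairs of incidences. Equal incidences give the linear term; distinct ones
    differ in both coordinates since [pi] is injective. *)
Lemma card_setI_perm_sqr A B pi : #|A :&: pi @: B|%:R ^+ 2 =
  #|A :&: pi @: B|%:R + \sum_(a in A) \sum_(b in B)
    \sum_(a' in A :\ a) \sum_(b' in B :\ b) ((pi b == a) && (pi b' == a'))%:R
      :> R.
Proof.
rewrite expr2 {1}card_setI_perm [in RHS]card_setI_perm mulr_suml -big_split /=.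
apply: eq_bigr => a aA; rewrite mulr_suml -big_split /=.
apply: eq_bigr => b bB; case: eqP => [ba|_]; last first.
  by rewrite mul0r add0r big1 // => a' _; rewrite big1.
rewrite mul1r -card_setI_perm.
rewrite (cardsD1 a) inE aA -{1}ba imset_f //= natrD; congr (1 + _%:R).
apply: eq_card => c; rewrite in_setD1 !in_setI in_setD1.
case: (eqVneq c a) => //= ca; congr andb.
apply/imsetP/imsetP => -[b' b'B cb']; exists b' => //.
  by rewrite !inE b'B andbT; apply: contraNneq ca => bb'; rewrite cb' bb' ba.
by move: b'B; rewrite !inE => /andP[].
Qed.

(** In other words, the variance is at most the mean [mu]. With [x] and [y] the sizes of [A] and
    [B], the distinct pairs reduce to [(x - 1) * (y - 1) <= x * y * (n - 1) / n], which follows from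
    [x <= n]. *)
Lemma sum_perm_card_sqr A B mu : (1 < #|T|)%N -> mu = #|A|%:R * #|B|%:R / n ->
  \sum_(pi : {perm T}) #|A :&: pi @: B|%:R ^+ 2 <= N * (mu + mu ^+ 2).
Proof.
move=> T1 ->.
have n0 : 0 < n by rewrite ltr0n; lia.
have n1 : 0 < n - 1 by rewrite subr_gt0 ltr1n.
under eq_bigr do rewrite card_setI_perm_sqr.
rewrite big_split /= mulrDr lerD //.
  have := sum_perm_card A B => /(canRL (mulfK (lt0r_neq0 n0))) ->.
  by rewrite !mulrA.
have -> : \sum_(pi : {perm T}) \sum_(a in A) \sum_(b in B) \sum_(a' in A :\ a)
  \sum_(b' in B :\ b)
            ((pi b == a) && (pi b' == a'))%:R =
  \sum_(a in A) \sum_(b in B) \sum_(a' in A :\ a) \sum_(b' in B :\ b) N / (n *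
    (n - 1)).
  rewrite exchange_big; apply: eq_bigr => a aA.
  rewrite exchange_big; apply: eq_bigr => b bB.
  rewrite exchange_big; apply: eq_bigr => a'; rewrite !inE => /andP[aa' _].
  rewrite exchange_big; apply: eq_bigr => b'; rewrite !inE => /andP[bb' _].
  by rewrite -(@sum_perm_move2 b b' a a') 1?eq_sym // mulfK
    // mulf_neq0 ?lt0r_neq0.
have cD (C : {set T}) c : c \in C -> #|C :\ c|%:R = #|C|%:R - 1 :> R.
  by move=> cC; rewrite (cardsD1 c C) cC natrD addrAC subrr add0r.
have -> : \sum_(a in A) \sum_(b in B) \sum_(a' in A :\ a) \sum_(b' in B :\ b)
  N / (n * (n - 1))
   = N / (n * (n - 1)) * (#|A|%:R * (#|A|%:R - 1) * (#|B|%:R * (#|B|%:R - 1))).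
  rewrite (eq_bigr (fun a => #|B|%:R * (#|B|%:R - 1) * (#|A|%:R - 1) * (N / (n
    * (n - 1))))).
    by rewrite sumr_const -[LHS]mulr_natr; ring.
  move=> a aA; rewrite (eq_bigr (fun a => (#|B|%:R - 1) * (#|A|%:R - 1) * (N /
    (n * (n - 1))))).
    by rewrite sumr_const -[LHS]mulr_natr; ring.
  move=> b bB; rewrite sumr_const sumr_const -mulrnA -[LHS]mulr_natr natrM !cD
    //; ring.
have le_n (C : {set T}) : #|C|%:R <= n by rewrite ler_nat max_card.
have := le_n A; have := le_n B.
move=> yn xn.
rewrite -mulrA ler_wpM2l //.
rewrite mulrC ler_pdivrMr ?mulr_gt0 //.
set x := #|A|%:R; set y := #|B|%:R.
have -> : (x * y / n) ^+ 2 * (n * (n - 1)) = x * y * (x * y * (n - 1) / n).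
  by field; rewrite lt0r_neq0.
have -> : x * (x - 1) * (y * (y - 1)) = x * y * ((x - 1) * (y - 1)) by ring.
rewrite {}/x {}/y.
case: (posnP #|A|) => [->|A0]; first by rewrite !mul0r.
case: (posnP #|B|) => [->|B0]; first by rewrite mulr0 !mul0r.
have x1 : 1 <= #|A|%:R :> R by rewrite ler1n.
have y1 : 1 <= #|B|%:R :> R by rewrite ler1n.
move: (#|A|%:R) (#|B|%:R) xn yn x1 y1 => x y xn yn x1 y1.
rewrite ler_wpM2l ?mulr_ge0 ?(le_trans ler01) // ler_pdivlMr //.
apply: (@le_trans _ _ ((x - 1) * n * y)); first nra.
have : (x - 1) * n <= x * (n - 1) by nra.
move=> /(ler_wpM2r (le_trans ler01 y1)); lra.
Qed.

(** Chebyshev's inequality for a deviation of [mu / 2], with variance at most [mu]. *)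
Lemma sum_perm_card_lt A B mu : (1 < #|T|)%N -> mu = #|A|%:R * #|B|%:R / n ->
  0 < mu ->
  \sum_(pi : {perm T}) ((#|A :&: pi @: B|%:R : R) < mu / 2)%R%:R <=
    N * (4 / mu).
Proof.
move=> T1 muE mu0.
have n0 : n != 0 by rewrite pnatr_eq0; lia.
apply: (@le_trans _ _ (\sum_(pi : {perm T}) (4 / mu ^+ 2) * (#|A :&: pi @:
  B|%:R - mu) ^+ 2)).
  apply: ler_sum => pi _; set x := #|_|%:R.
  have p4 : 0 < 4 / mu ^+ 2 by rewrite divr_gt0 ?exprn_gt0.
  case: (ltrP x (mu / 2)) => [xm|_]; last by rewrite mulr_ge0 ?sqr_ge0 ?ltW.
  rewrite mulrAC ler_pdivlMr ?exprn_gt0 // mul1r.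
  nra.
rewrite -mulr_sumr.
have E pi : (#|A :&: pi @: B|%:R - mu) ^+ 2 = #|A :&: pi @: B|%:R ^+ 2
    - 2 * mu * #|A :&: pi @: B|%:R + mu ^+ 2 by ring.
under eq_bigr do rewrite E.
rewrite big_split big_split /= sumr_const sumrN -mulr_sumr.
have S1 : \sum_(pi : {perm T}) #|A :&: pi @: B|%:R = N * mu.
  by rewrite muE !mulrA -sum_perm_card mulfK.
rewrite S1; have := sum_perm_card_sqr T1 muE; set S := \sum_(pi : {perm T}) _
  => SN.
rewrite -[mu ^+ 2 *+ _]mulr_natr.
have -> : N * (4 / mu) = 4 / mu ^+ 2 * (N * mu) by field; rewrite lt0r_neq0.
rewrite ler_wpM2l ?divr_ge0 ?sqr_ge0 //; move: SN; lra.
Qed.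

End RandomPermutation.

(** * Numeric estimates for the rounds and the tries *)

Section NumericBounds.
Variable R : realType.
Implicit Types x eps : R.

Lemma nceil_ge x : x <= (nceil x)%:R.
Proof. by apply: le_trans (ceil_ge x) _; rewrite natr_absz ler_int ler_norm.
  Qed.

Lemma nceil_lt x : 0 <= x -> (nceil x)%:R < x + 1.
Proof.
move=> x0; have c0 : 0 <= Num.ceil x by rewrite ceil_ge0; lra.
rewrite natr_absz ger0_norm //.
have /andP[+ _] := ceil_itv x; rewrite intrB; lra.
Qed.

Lemma nrounds_gt eps : eps^-1 * ln eps^-1 < (nrounds eps)%:R + 1.
Proof. by rewrite natr1 truncnS_gt. Qed.

Lemma expr_oneB_le_expR x n : x <= 1 -> (1 - x) ^+ n <= expR (- (n%:R * x)).
Proof.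
move=> x1; rewrite -mulrN expRM_natl lerXn2r ?nnegrE ?expR_ge0 ?subr_ge0 //.
by have := expR_ge1Dx (- x).
Qed.

Lemma expR_lnV eps : 0 < eps -> expR (- ln eps^-1) = eps.
Proof. by move=> e0; rewrite lnV ?posrE // opprK lnK ?posrE. Qed.

(** The power is at most e^(- eps T), and eps T > log (1/eps) - eps; rounding [T] down thus costs a
    factor e^eps, which is at most 2. *)
Lemma last_round_le eps : 0 < eps < 1 / 10 -> (1 - eps) ^+ nrounds eps <=
  2 * eps.
Proof.
move=> /andP[e0 e1]; apply: le_trans (expr_oneB_le_expR _ _) _; first lra.
have T1 := nrounds_gt eps.
have : - ((nrounds eps)%:R * eps) <= eps - ln eps^-1.
  have : ln eps^-1 < ((nrounds eps)%:R + 1) * eps.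
    by rewrite -ltr_pdivrMr // mulrC.
  lra.
rewrite -ler_expR => /le_trans; apply; rewrite expRD expR_lnV
  // ler_wpM2r ?ltW //.
have h : 1 - eps <= expR (- eps) by exact: expR_ge1Dx.
have : expR eps * expR (- eps) = 1 by rewrite expRxMexpNx_1.
have := expR_gt0 eps; move: (expR eps) (expR (- eps)) h => x y h x0 xy.
nra.
Qed.

(** Here [eps ^+ 2 / 8] is the chance that a single try is guaranteed to have in [sum_perm_miss];
    the constant in [ntries] is fitted to it. *)
Lemma ntries_miss_le eps : 0 < eps < 1 ->
  expR (- ((ntries eps)%:R * (eps ^+ 2 / 8))) <= eps.
Proof.
move=> /andP[e0 e1]; rewrite -[leRHS]expR_lnV // ler_expR lerN2.
have := nceil_ge (8 / eps ^+ 2 * ln eps^-1).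
rewrite -/(ntries eps) => h.
have p : 0 < eps ^+ 2 / 8 by rewrite divr_gt0 ?exprn_gt0.
apply: le_trans (ler_wpM2r (ltW p) h).
rewrite le_eqVlt; apply/orP; left; apply/eqP; field.
by rewrite lt0r_neq0.
Qed.

End NumericBounds.

(** * Edges without color, and all causes of failure together *)

Section EdgeFailureBound.
Variables (R : realType) (V : finType) (E : {set {set V}}) (eps D : R).
Variable H : {set edge E}.
Local Notation T := (nrounds eps).
Local Notation K := (ntries eps).
Local Notation q := (palette_size eps D).
Local Notation color := 'I_q.
Local Notation seed := (nibble_seed E eps D).
Local Notation entry := ('I_T.+1 * {ffun 'I_K -> color})%type.
Local Notation w := (@nibble_pmf R V E eps D).
Implicit Types (s : seed) (e f g : edge E) (x y u v : V).

Hypothesis eps01 : 0 < eps < 1 / 10.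
Hypothesis D_ge : 8 / eps ^+ 3 <= D.
Hypothesis q_ge : (1 + eps) * D <= q%:R.
Hypothesis q_le : q%:R <= 2 * D.
Hypothesis deg_le : forall x, #|[set g in H | incident x g]|%:R <= D.

Lemma D_gt : 8 < D.
Proof.
case/andP: eps01 => e0 e1; apply: lt_le_trans D_ge.
rewrite ltr_pdivlMr ?exprn_gt0 //.
have : eps ^+ 3 < 1 by rewrite exprn_ilt1 //; lra.
lra.
Qed.

Lemma q_gt1 : (1 < q)%N.
Proof.
case/andP: eps01 => e0 e1; rewrite -(ltr1n R); have := D_gt; have := q_ge; nra.
Qed.

Lemma deg_le_palette x : (#|[set g in H | incident x g]| <= q)%N.
Proof.
case/andP: eps01 => e0 e1; rewrite -(ler_nat R).
have := D_gt; have := q_ge; have := deg_le x; nra.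
Qed.

Lemma palette_ge s i x : eps * D <= #|palette H s i x|%:R.
Proof.
have := card_palette H s i x; rewrite -(ler_nat R) natrD.
set B := [set g in H | _ & _] => h.
have : #|B|%:R <= D :> R.
  apply: le_trans (deg_le x); rewrite ler_nat;
    apply/subset_leq_card/subsetP => g.
  by rewrite !inE => /and3P[-> ->].
have := q_ge; lra.
Qed.

(** The mean number [mu] of common colors is at least [eps ^+ 2 * D / 2], and [D_ge] makes the
    exceptional fraction [4 / mu] at most [eps]. For the other permutations at least [mu / 2] colors
    are common, so each try hits one with probability at least [eps ^+ 2 / 8], and all [K] tries
    miss with probability at most [eps]. *)
Lemma sum_perm_miss (A B : {set color}) :
  eps * D <= #|A|%:R -> eps * D <= #|B|%:R ->
  \sum_(pi : {perm color}) (1 - #|A :&: pi @: B|%:R / q%:R) ^+ K <=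
  #|{perm color}|%:R * (2 * eps).
Proof.
move=> cA cB; case/andP: eps01 => e0 e1.
have D8 := D_gt; have q1 := q_gt1.
have q0 : 0 < q%:R :> R by rewrite ltr0n; lia.
have eD : 0 < eps * D by rewrite mulr_gt0 //; lra.
pose mu : R := #|A|%:R * #|B|%:R / q%:R.
have AB : (eps * D) ^+ 2 <= #|A|%:R * #|B|%:R by rewrite expr2 ler_pM // ltW.
have mu_ge : eps ^+ 2 * D / 2 <= mu.
  rewrite /mu ler_pdivlMr //; apply: le_trans AB.
  rewrite exprMn; have : 0 <= eps ^+ 2 * D by rewrite mulr_ge0 ?sqr_ge0 //; lra.
  by move=> /(ler_wpM2r)/(_ _ _ q_le); rewrite expr2; lra.
have mu0 : 0 < mu.
  by apply: lt_le_trans mu_ge; rewrite divr_gt0 ?mulr_gt0 ?exprn_gt0 //; lra.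
have mue : 4 / mu <= eps.
  rewrite ler_pdivrMr //; move: D_ge; rewrite ler_pdivrMr ?exprn_gt0 // => h.
  by apply: le_trans (ler_wpM2l (ltW e0) mu_ge); rewrite -subr_ge0; lra.
apply: (@le_trans _ _ (\sum_(pi : {perm color})
    (((#|A :&: pi @: B|%:R : R) < mu / 2)%R%:R + eps))).
  apply: ler_sum => pi _; set x := #|_|%:R.
  have x0 : 0 <= x / q%:R by rewrite divr_ge0 ?ler0n.
  have x1 : x / q%:R <= 1.
    by rewrite ler_pdivrMr // mul1r ler_nat; apply: leq_trans (max_card _) _;
      rewrite card_ord.
  case: ltrP => [_|xmu].
    by apply: ler_wpDr; [exact: ltW | rewrite exprn_ile1 //; lra].
  rewrite add0r; apply: le_trans (expr_oneB_le_expR _ x1) _.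
  apply: le_trans (ntries_miss_le _); last by rewrite e0 /=; lra.
  rewrite ler_expR lerN2 ler_wpM2l ?ler0n // ler_pdivlMr //.
  apply: le_trans xmu; rewrite /mu [leRHS]mulrAC ler_pdivlMr //.
  have : q%:R ^+ 2 <= (2 * D) ^+ 2 by rewrite lerXn2r ?nnegrE ?ler0n //; lra.
  move=> /(ler_wpM2l (sqr_ge0 eps)); move: AB; rewrite !exprMn; lra.
rewrite big_split /= sumr_const -[eps *+ _]mulr_natl.
have := @sum_perm_card_lt R color A B mu.
rewrite card_ord => /(_ q1 erefl mu0) h.
rewrite [2 * eps]mulr_natl mulr2n mulrDr lerD //.
by apply: le_trans h _; rewrite ler_wpM2l ?ler0n.
Qed.

(** Before its own round [e] has no color and no palette reads it, so its seed has no influence. *)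
Lemma tentative_upto_agree s s' e m :
  (forall g, g != e -> s g = s' g) ->
  (m <= round_of s e)%N -> (m <= round_of s' e)%N ->
  tentative_upto H s m =1 tentative_upto H s' m.
Proof.
move=> ss'; elim: m => [//|m IH] me me' g.
case: (eqVneq g e) => [->|ge]; first by rewrite !tentative_upto_late.
have IHm := IH (ltnW me) (ltnW me').
have rss g' : g' != e -> round_of s g' = round_of s' g'.
  by move=> ge'; rewrite /round_of ss'.
rewrite /= rss // IHm; case: ifP => // _.
rewrite /first_color ss' //; congr ohead; apply: eq_filter => c.
rewrite !edge_palette_in; apply: eq_forallb => x; congr (_ ==> _).
rewrite !in_set; apply: eq_forallb => f; rewrite IHm.
case: (eqVneq f e) => [->|fe]; last by rewrite rss.
by rewrite !ltnNge (ltnW me) (ltnW me') andbF.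
Qed.

Lemma palette_agree s s' e i x :
  (forall g, g != e -> s g = s' g) ->
  (i <= round_of s e)%N -> (i <= round_of s' e)%N ->
  palette H s i x = palette H s' i x.
Proof.
move=> ss' ie ie'; apply/setP => c; rewrite !palette_in.
apply: eq_forallb => f; rewrite (tentative_upto_agree ss' ie ie').
case: (eqVneq f e) => [->|fe]; last by rewrite /round_of ss'.
by rewrite !ltnNge ie ie' andbF.
Qed.

Lemma palette_upd s e (a b : entry) x : a.1 = b.1 ->
  palette H (upd s e a : seed) a.1 x = palette H (upd s e b : seed) a.1 x.
Proof.
move=> ab; apply: (@palette_agree _ _ e).
- by move=> g ge; apply: etrans (upd_neq _ _ ge) (esym (upd_neq _ _ ge)).
- by rewrite round_upd eqxx.
- by rewrite round_upd eqxx ab.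
Qed.

Section Edge.
Variables (e : edge E) (u v : V).
Hypothesis eH : e \in H.
Hypothesis e_uv : val e = [set u; v].
Hypothesis e_tree : forall g, g \in H :\ e ->
  ~~ (touches (ball (H :\ e) u T) g && touches (ball (H :\ e) v T) g).

Local Notation Pal s x := (palette H s (round_of s e) x).

Definition uncolored s := (round_of s e < T)%N && (tentative H s e == None).

(** In contrast to [side_edge_tau], the tries of [e] are kept: the palette of [v] moves relative to
    both the palette of [u] and the tries. *)
Definition v_side (pi : {perm color}) : edge E -> {perm color} :=
  fun g => if (g != e) && touches (ball (H :\ e) v T) g then pi else 1%g.

Definition missed s (S : {set color}) := [forall l, (s e).2 l \notin S].

Lemma missed_upd s (a : entry) S :
  missed (upd s e a : seed) S = [forall l, a.2 l \notin S].
Proof. by apply: eq_forallb => l; congr (_ l \notin S); rewrite upd_eq. Qed.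

Lemma uncolored_recolor (pi : {perm color}) s :
  uncolored (recolor (v_side pi) s) =
  (round_of s e < T)%N && missed s (Pal s u :&: pi @: Pal s v).
Proof.
rewrite /uncolored round_recolor; case: (ltnP (round_of s e) T) => //= eT.
rewrite (tentativeE eH _ e_uv) ?round_recolor // first_color_none.
apply: eq_forallb => l; rewrite ffunE /= ffunE {1}/v_side eqxx perm1.
congr (~~ _); rewrite !in_setI; congr (_ && _).
  rewrite -[in LHS](round_recolor (v_side pi) s e).
  apply: (Pal_u_recolor e_tree) => // g; rewrite in_setD1 => /andP[ge _] gv.
  by rewrite /v_side gv andbF.
set c := (s e).2 l; rewrite -[c in LHS](permKV pi).
rewrite -[in LHS](round_recolor (v_side pi) s e).
rewrite (@Pal_v_recolor _ _ _ _ _ H e v) //.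
  by rewrite -[c in RHS](permKV pi) (mem_imset _ _ (@perm_inj _ pi)).
by move=> g; rewrite in_setD1 /v_side => /andP[-> _] ->.
Qed.

(* Averaging over all recolorings of the v-side turns the two palettes at the
   ends of e into sets in uniformly random relative position. *)
Lemma prob_uncolored : prob w uncolored <= 2 * eps.
Proof.
case/andP: eps01 => e0 e1.
have eps1 : 0 < eps < 1 by rewrite e0 /=; lra.
have q0 : (0 < q)%N := ltnW q_gt1.
have wP : pmf w := nibble_pmfP E eps1 q0.
have N0 : 0 < #|{perm color}|%:R :> R.
  by rewrite ltr0n; apply/card_gt0P; exists 1%g.
rewrite -(ler_pM2l N0).
have -> : #|{perm color}|%:R * prob w uncolored =
    expect w (fun s => \sum_(pi : {perm color})
      ((round_of s e < T)%N && missed s (Pal s u :&: pi @: Pal s v))%:R).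
  rewrite expect_sum mulr_natl -sumr_const; apply: eq_bigr => pi _.
  rewrite prob_expect -(expect_bij _ (@recolor_bij _ _ _ _ _ (v_side pi))
             (@nibble_pmf_recolor _ _ _ _ _ (v_side pi))).
  by apply: eq_expect => s; rewrite uncolored_recolor.
(* Once all seeds but that of [e] are fixed, the round of [e] determines both palettes, and the
   tries are independent of them. *)
rewrite (expect_resample e _ (seed_entry_pmfP eps1 q0)).
rewrite -[leRHS](expect_cst wP); apply: ler_expect => // s.
rewrite expect_pair -[leRHS](expect_cst (round_pmfP eps1)).
apply: ler_expect => [|i]; first exact: round_pmfP.
have eps2 : 0 <= 2 * eps by lra.
have ue (b : {ffun 'I_K -> color}) : round_of (upd s e (i, b) : seed) e = i.
  by rewrite round_upd eqxx.
case: (ltnP i T) => iT; last first.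
  under eq_expect => b.
    rewrite big1 => [|pi _]; [over | by rewrite ue ltnNge iT].
  rewrite /expect; under eq_bigr => b _ do rewrite mulr0.
  by rewrite big1 // mulr_ge0 // ltW.
have [c0 _] : exists c : color, true by exists (Ordinal q0).
(* The tries given to [e] in [s0] are arbitrary, as the palettes in round [i] do not read them. *)
pose s0 : seed := upd s e (i, [ffun=> c0]).
have PE b x : palette H (upd s e (i, b) : seed) i x = palette H s0 i x.
  exact: (@palette_upd s e (i, b) (i, [ffun=> c0]) x erefl).
pose S (pi : {perm color}) := palette H s0 i u :&: pi @: palette H s0 i v.
have missE b (pi : {perm color}) : missed (upd s e (i, b) : seed)
    (palette H (upd s e (i, b) : seed) i u :&:
     pi @: palette H (upd s e (i, b) : seed) i v) = [forall l, b l \notin S pi].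
  rewrite (missed_upd s (i, b)).
  exact: (congr2 (fun A B : {set color} => [forall l, b l \notin A :&: pi @: B])
            (PE b u) (PE b v)).
under eq_expect => b.
  rewrite ue iT; under eq_bigr => pi _ do rewrite missE /=.
  over.
rewrite expect_sum.
apply: le_trans (sum_perm_miss (palette_ge s0 i u) (palette_ge s0 i v)).
apply: ler_sum => pi _; rewrite -/(S pi).
have -> : expect (iid_pmf (@uniform_pmf R color))
     (fun b : {ffun 'I_K -> color} => ([forall l, b l \notin S pi])%:R) =
   expect (iid_pmf (@uniform_pmf R color))
     (fun b : {ffun 'I_K -> color} => \prod_l (b l \notin S pi)%:R).
  apply: eq_expect => b; case: forallP => [h|nh].
    by rewrite big1 // => l _; rewrite h.
  have /existsP[l hl] : [exists l, ~~ (b l \notin S pi)].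
    by rewrite -negb_forall; apply/forallP.
  by rewrite (bigD1 l) //= (negPf hl) mul0r.
rewrite (expect_iid_prod _ (fun _ c => (c \notin S pi)%:R)).
rewrite prodr_const card_ord.
have uP : pmf (@uniform_pmf R color) by apply: uniform_pmfP; rewrite card_ord.
rewrite (_ : expect _ _ = 1 - #|S pi|%:R / q%:R) //.
rewrite -(prob_expect _ (fun c => c \notin S pi)) (prob_compl uP);
  congr (1 - _).
rewrite /prob (eq_bigl (fun c => c \in S pi)) => [|c]; last by rewrite /= negbK.
by rewrite sumr_const -[LHS]mulr_natl /uniform_pmf card_ord.
Qed.

End Edge.

(** The last class and the lack of a color contribute [2 * eps] each, collisions at [u] and at [v]
    contribute [eps] each. The absence of short cycles is symmetric in the two ends, so one
    collision bound serves both. *)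
Lemma prob_edge_failed e u v : e \in H -> val e = [set u; v] ->
  (forall g, g \in H :\ e ->
    ~~ (touches (ball (H :\ e) u T) g && touches (ball (H :\ e) v T) g)) ->
  prob w (fun s => e \in nibble_failed H s) <= 6 * eps.
Proof.
move=> eH euv tree; case/andP: (eps01) => e0 e1.
have eps1 : 0 < eps < 1 by rewrite e0 /=; lra.
have q0 : (0 < q)%N := ltnW q_gt1.
have wP : pmf w := nibble_pmfP E eps1 q0.
pose coll x s : R := \sum_(f in H :\ e | incident x f) (collision H e s f)%:R.
have cu : expect w (coll u) <= eps.
  rewrite expect_sum.
  under eq_bigr => f _ do rewrite -prob_expect.
  exact: (sum_collision_le eps1 q0 eH euv tree (deg_le_palette u)).
have cv : expect w (coll v) <= eps.
  rewrite expect_sum.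
  under eq_bigr => f _ do rewrite -prob_expect.
  apply: (sum_collision_le eps1 q0 (u := v) (v := u)) => //.
  - by rewrite setUC.
  - by move=> g gH; rewrite andbC; exact: tree.
  - exact: deg_le_palette.
have bot := prob_uncolored eH euv tree.
have lastr : prob w (fun s => round_of s e == T) <= 2 * eps.
  apply: le_trans (last_round_le eps01).
  rewrite prob_expect (expect_coord e (fun a : entry =>
    (a.1 == T :> nat)%:R)); last first.
    exact: seed_entry_pmfP.
  rewrite expect_pair /expect big_ord_recr /= big1 ?add0r => [|a _]; last first.
    by rewrite big1 ?mulr0 // => b _; rewrite (ltn_eqF (ltn_ord a)) mulr0.
  under eq_bigr do rewrite eqxx mulr1.
  have [_ ->] : pmf (iid_pmf (@uniform_pmf R color) : {ffun 'I_K -> color} ->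
    R).
    by apply/iid_pmfP/uniform_pmfP; rewrite card_ord.
  by rewrite mulr1 /round_pmf ltnn.
apply: (@le_trans _ _ (expect w (fun s => (round_of s e == T)%:R
    + (uncolored e s)%:R + (coll u s + coll v s)))); last first.
  by rewrite !expectD -!prob_expect; lra.
rewrite prob_expect; apply: ler_expect => // s.
have coll0 x : 0 <= coll x s by apply: sumr_ge0 => f _; rewrite ler0n.
case: (boolP (e \in _)) => [|_]; last by rewrite !addr_ge0 ?ler0n.
have coll1 x f : f \in H :\ e -> incident x f -> collision H e s f ->
  1 <= coll x s.
  move=> fH xf Cf; rewrite /coll (bigD1 f) ?fH //= Cf lerDl.
  by apply: sumr_ge0 => g _; rewrite ler0n.
rewrite inE eH /uncolored /= => /or3P[->|eN|/existsP[f /andP[fH /and3P[fe rfe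
  tfe]]]].
- by rewrite -addrA lerDl !addr_ge0 ?ler0n.
- case: (eqVneq (round_of s e) T) => eT; first by rewrite -addrA lerDl
  !addr_ge0 ?ler0n.
  rewrite eN ltn_neqAle eT -ltnS ltn_ord add0r /= lerDl addr_ge0 //.
- case: (eqVneq (round_of s e) T) => eT; first by rewrite -addrA lerDl
  !addr_ge0 ?ler0n.
  have lT : (round_of s e < T)%N by rewrite ltn_neqAle eT -ltnS ltn_ord.
  case: (eqVneq (tentative H s e) None) => eN;
    first by rewrite lT add0r /= lerDl addr_ge0.
  rewrite lT !add0r.
  have Cf : collision H e s f by apply/and4P.
  case/andP: fe => fe /existsP[x /andP[xf]].
  have fHe : f \in H :\ e by rewrite in_setD1 fe.
  rewrite /incident euv in_set2 => /orP[]/eqP xu; rewrite xu in xf.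
  + by rewrite ler_wpDr // (coll1 _ f).
  + by rewrite ler_wpDl // (coll1 _ f).
Qed.

End EdgeFailureBound.

(** * Short cycles in the random parts *)

Section DisjointOccurrence.
Variables (R : realType) (I J X : finType) (a : X -> R) (es : X -> {set I}).
Hypothesis a_ge0 : forall x, 0 <= a x.
Hypothesis J_gt0 : (0 < #|J|)%N.
Local Notation wJ := (@uniform_pmf R J).

(* For a choice of one set for each j, the events that the sets are mapped to
   their values j are independent if the sets are pairwise disjoint, and
   incompatible otherwise. *)
Lemma expect_prod_occurrence :
  expect (iid_pmf wJ) (fun om : {ffun I -> J} =>
    \prod_j \sum_x a x * ([forall i in es x, om i == j])%:R) <=
  (\sum_x a x * #|J|%:R^-1 ^+ #|es x|) ^+ #|J|.
Proof.
have wP : pmf wJ by exact: uniform_pmfP.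
have wIP : pmf (iid_pmf wJ : {ffun I -> J} -> R) by exact: iid_pmfP.
under eq_expect => om do rewrite bigA_distr_bigA /=.
rewrite expect_sum -[X in _ <= X ^+ _]/(\sum_x _) -prodr_const.
rewrite bigA_distr_bigA /=; apply: ler_sum => f _.
(* The conditions are regrouped by the elements [i], whose values are independent. *)
have Eom om : \prod_j (a (f j) * ([forall i in es (f j), om i == j])%:R) =
    \prod_j a (f j) * \prod_i \prod_j ((i \in es (f j)) ==> (om i == j))%:R :>
      R.
  rewrite big_split /= exchange_big; congr (_ * _); apply: eq_bigr => j _.
  case: forallP => [h|nh]; first by rewrite big1 // => i _; rewrite h.
  have /existsP[i hi] : [exists i, ~~ ((i \in es (f j)) ==> (om i == j))].
    by rewrite -negb_forall; apply/forallP.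
  by rewrite (bigD1 i) //= (negPf hi) mul0r.
under eq_expect => om do rewrite Eom.
rewrite expectZ big_split /= ler_wpM2l //; first exact: prodr_ge0.
rewrite (expect_iid_prod _ (fun i c => \prod_j ((i \in es (f j)) ==> (c ==
  j))%:R)).
have -> : \prod_j (#|J|%:R^-1 : R) ^+ #|es (f j)| =
    \prod_i \prod_j (if i \in es (f j) then #|J|%:R^-1 else 1 : R).
  rewrite exchange_big; apply: eq_bigr => j _.
  by rewrite -big_mkcond prodr_const.
apply: ler_prod => i _; apply/andP; split.
  by apply: expect_ge0 => // c; apply: prodr_ge0.
have y0 : 0 <= #|J|%:R^-1 :> R by rewrite invr_ge0.
(* If [i] lies in no chosen set, its factor is at most 1; if it lies in two, the requirements
   contradict each other and the expectation is 0; if it lies in exactly one, the expectation is at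
   most the inverse of [#|J|]. *)
case: (pickP (fun j => i \in es (f j))) => [j0 ij0|none]; last first.
  rewrite [leRHS]big1 => [|j _]; last by rewrite none.
  rewrite -[leRHS](expect_cst wP); apply: ler_expect => // c.
  by rewrite big1 // => j _; rewrite none.
case: (pickP (fun j => (j != j0) && (i \in es (f j)))) =>
  [j1 /andP[j10 ij1]|one].
  rewrite (@eq_expect _ _ _ _ (fun=> 0)); last first.
    move=> c; case: (eqVneq c j0) => [->|cj].
      by rewrite (bigD1 j1) //= ij1 eq_sym (negPf j10) mul0r.
    by rewrite (bigD1 j0) //= ij0 (negPf cj) mul0r.
  by rewrite expect_cst //; apply: prodr_ge0 => j _; case: ifP.
rewrite [leRHS](bigD1 j0) //= ij0 [X in _ <= _ * X]big1 ?mulr1; last first.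
  by move=> j jj0; have := one j; rewrite jj0 /= => ->.
rewrite -[leRHS](_ : prob wJ (pred1 j0) = _); last by rewrite /prob
  big_pred1_eq.
rewrite prob_expect; apply: ler_expect => // c.
rewrite (bigD1 j0) //= ij0 /= ler_piMr ?ler0n //.
by apply: prodr_ile1 => j _; rewrite ler0n lern1 leq_b1.
Qed.

End DisjointOccurrence.

(** * Short cycles and their enumeration by walks *)

Section Cycles.
Variables (V : finType) (E : {set {set V}}).
Hypothesis E_simple : simple_graph E.
Implicit Types (e g : edge E) (x y u v : V) (F : {set edge E}) (p : seq V).

Definition adj F x y := (x != y) && [exists g in F, val g == [set x; y]].

Lemma adj_sym F : symmetric (adj F).
Proof. by move=> x y; rewrite /adj eq_sym setUC. Qed.

Lemma incident2 x y g : x != y -> incident x g -> incident y g ->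
  val g = [set x; y].
Proof.
move=> xy xg yg; apply/esym/eqP; rewrite eqEcard subUset !sub1set -!/(incident
  _ _).
by rewrite xg yg (E_simple (valP g)) cards2 xy.
Qed.

Lemma ball_path F x r y : y \in ball F x r ->
  exists p, [/\ path (adj F) x p, last x p = y & (size p <= r)%N].
Proof.
elim: r y => [|r IH] y /=; first by rewrite inE => /eqP ->; exists [::].
rewrite inE => /orP[/IH[p [xp py pr]]|]; first by exists p; rewrite leqW.
case/existsP=> g /and3P[gF yg /existsP[z /andP[/IH[p [xp pz pr]] zg]]].
case: (eqVneq z y) => [zy|zy]; first by exists p; rewrite pz leqW.
exists (rcons p y); rewrite last_rcons size_rcons ltnS rcons_path xp pz /adj zy.
by split=> //=; apply/existsP; exists g; rewrite gF (incident2 zy zg yg) /=.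
Qed.

(** At most [r] steps from [u], at most one along [g], and at most [r] on to [v]. *)
Lemma touches_path F r u v g : g \in F -> touches (ball F u r) g ->
  touches (ball F v r) g ->
  exists p, [/\ path (adj F) u p, last u p = v & (size p <= (r.*2).+1)%N].
Proof.
move=> gF /existsP[y /andP[/ball_path[p [up py pr]] yg]].
case/existsP=> z /andP[/ball_path[p' [vp' pz pr']] zg].
have zv : exists p2, [/\ path (adj F) z p2, last z p2 = v & (size p2 <= r)%N].
  exists (rev (belast v p')); split; last by rewrite size_rev size_belast.
    by rewrite -pz -rev_path (eq_path (fun x y => adj_sym F y x)) in vp' *.
  by rewrite -pz; case: (p') => //= a s; rewrite rev_cons last_rcons.
case: zv => p2 [zp2 p2v p2r].
case: (eqVneq y z) => [yz|yz].
  exists (p ++ p2); rewrite cat_path last_cat size_cat up py yz zp2 p2v.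
  by split=> //; lia.
exists (p ++ z :: p2); rewrite cat_path last_cat size_cat up py /= zp2 p2v
  andbT.
split=> //; last by lia.
by rewrite /adj yz; apply/existsP; exists g; rewrite gF (incident2 yz yg zg) /=.
Qed.

(** The list [p] omits the start [u]; the pair that closes the cycle comes first. *)
Definition cycle_sets u p : seq {set V} :=
  [set last u p; u] :: pairmap (fun x y => [set x; y]) u p.

Definition cycle_edges u p : {set edge E} :=
  [set g | val g \in cycle_sets u p].

Lemma pairmap_sub u p S : S \in pairmap (fun x y => [set x; y]) u p ->
  S \subset u :: p.
Proof.
elim: p u => //= y p IH u; rewrite inE => /orP[/eqP ->|/IH yp].
  by apply/subsetP => z; rewrite !inE => /orP[] ->; rewrite ?orbT.
by apply: subset_trans yp _; apply/subsetP => z; rewrite !inE => ->;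
  rewrite orbT.
Qed.

(** With [1 < size p] there are at least three vertices, so the closing pair is none of the
    others. *)
Lemma uniq_cycle_sets u p : uniq (u :: p) -> (1 < size p)%N ->
  uniq (cycle_sets u p).
Proof.
have notin y x s : x \notin y :: s -> forall z,
    [set x; z] \notin pairmap (fun x y => [set x; y]) y s.
  move=> xs z; apply: contra xs => /pairmap_sub/subsetP/(_ x).
  by apply; rewrite !inE eqxx.
move=> /= /andP[up pU] p1; apply/andP; split; last first.
  elim: p u pU up {p1} => //= y p IH u /andP[yp pU] uyp.
  by rewrite notin // IH.
case: p up pU p1 => [//|y [//|z p]] /= up /andP[yzp pU] _.
rewrite inE negb_or; apply/andP; split.
  apply/eqP => /setP/(_ (last z p)); rewrite !inE eqxx /= =>
    /esym/orP[] /eqP lu.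
    by move: up; rewrite -lu inE mem_last orbT.
  by move: yzp; rewrite -lu mem_last.
by rewrite setUC; apply: (notin y u (z :: p)).
Qed.

Lemma pairmap_adj F u p S : path (adj F) u p ->
  S \in pairmap (fun x y => [set x; y]) u p -> exists2 g, g \in F & val g = S.
Proof.
elim: p u => //= y p IH u /andP[/andP[_ /existsP[g /andP[gF /eqP gS]]] yp].
by rewrite inE => /orP[/eqP ->|]; [exists g | exact: IH].
Qed.

Lemma card_cycle_edges F u p : path (adj F) u p -> adj setT (last u p) u ->
  uniq (u :: p) -> (1 < size p)%N -> #|cycle_edges u p| = (size p).+1.
Proof.
move=> up lu pU p1.
have inE_ S : S \in cycle_sets u p -> S \in E.
  rewrite inE => /orP[/eqP ->|].
    by case/andP: lu => _ /existsP[g /andP[_ /eqP <-]]; exact: valP.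
  by move=> /(pairmap_adj up)[g _ <-]; exact: valP.
have -> : (size p).+1 = size (cycle_sets u p) by rewrite /= size_pairmap.
rewrite -(card_uniqP (uniq_cycle_sets pU p1)) -(card_imset _ val_inj).
apply: eq_card => S; apply/imsetP/idP => [[g + ->]|SC]; first by rewrite inE.
by exists (Sub S (inE_ S SC)); rewrite ?inE SubK.
Qed.

Definition nbrs x : seq V := enum [pred y | adj setT x y].

Fixpoint walks m x : seq (seq V) :=
  if m is m'.+1 then [seq y :: p | y <- nbrs x, p <- walks m' y] else [:: [::]].

Lemma path_walks F x p : path (adj F) x p -> p \in walks (size p) x.
Proof.
elim: p x => [|y p IH] x //= /andP[xy /IH yp].
apply/allpairsPdep; exists y, p; split=> //.
rewrite mem_enum inE; case/andP: xy => xy /existsP[g /andP[_ gxy]].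
by rewrite /adj xy; apply/existsP; exists g; rewrite inE.
Qed.

Lemma size_nbrs x : (size (nbrs x) <= max_degree [set: edge E])%N.
Proof.
apply: leq_trans (leq_bigmax x); rewrite -cardE.
rewrite -(@card_in_imset _ _ (fun y => [set x; y])) => [|y z].
  rewrite -[leqRHS](card_imset _ val_inj); apply/subset_leq_card/subsetP => S.
  case/imsetP=> y; rewrite inE => /andP[_ /existsP[g /andP[_ /eqP gxy]]] ->.
  by apply/imsetP; exists g => //; rewrite !inE /incident gxy !inE eqxx.
rewrite !inE => /andP[xy _] _ /setP/(_ y); rewrite !inE eqxx orbT.
by rewrite eq_sym (negPf xy) /= => /esym/eqP.
Qed.

Lemma size_walks m x : (size (walks m x) <= max_degree [set: edge E] ^ m)%N.
Proof.
elim: m x => //= m IH x; rewrite size_allpairs_dep expnS.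
apply: leq_trans (leq_mul (size_nbrs x) (leqnn _)).
elim: (nbrs x) => //= y s IHs; rewrite mulSn leq_add //.
Qed.

(** The condition on [#|C|] forces the closing pair to be an edge and all edges to be distinct.
    These closed trails include every cycle through [u] with 3 to [N + 1] edges; for [N = 2T + 1]
    the bound is 2T + 2. *)
Definition short_cycles N u : {set {set edge E}} :=
  [set C | [exists m : 'I_N.+1, (1 < m)%N &&
     has (fun p => (C == cycle_edges u p) && (#|C| == m.+1)) (walks m u)]].

(* If g joins the two balls, the walk from u to v through g closes up with e. *)
Lemma short_cycles_touches F r e u v g : e \in F -> val e = [set u; v] ->
  g \in F :\ e -> touches (ball (F :\ e) u r) g ->
  touches (ball (F :\ e) v r) g ->
  exists2 C, C \in short_cycles (r.*2).+1 u & C \subset F.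
Proof.
move=> eF euv gF ug vg.
have [p0 [up0 lp0 sp0]] := touches_path gF ug vg.
have uv : u != v.
  have := E_simple (valP e); rewrite euv cards2; by case: (u != v).
have [p up [pU pp0 lp]] : exists2 p, path (adj (F :\ e)) u p &
    [/\ uniq (u :: p), (size p <= size p0)%N & last u p = v].
  case: (shortenP up0) lp0 => p up pU sub <-; exists p => //; split=> //.
  by apply: uniq_leq_size => //; case/andP: pU.
(* A path of a single step would be [e] itself, which was removed. *)
have p1 : (1 < size p)%N.
  case: p {pU pp0} up lp => [_ ?|y [|//]] /=; first by case/eqP: uv.
  rewrite andbT => /andP[_ /existsP[g' /andP[+ /eqP g'y]]] yv.
  rewrite in_setD1 => /andP[/eqP g'e _]; case: g'e; apply: val_inj.
  by rewrite /= g'y yv euv.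
have lu : adj setT (last u p) u.
  rewrite lp /adj eq_sym uv; apply/existsP; exists e.
  by rewrite inE euv setUC /=.
exists (cycle_edges u p).
  have mN : (size p < (r.*2).+2)%N by rewrite ltnS (leq_trans pp0).
  rewrite inE; apply/existsP; exists (Ordinal mN); rewrite /= p1 /=.
  apply/hasP; exists p; first exact: path_walks up.
  by rewrite eqxx (card_cycle_edges up lu pU p1) /=.
apply/subsetP => g'; rewrite inE inE lp => /orP[/eqP g'e|/(pairmap_adj up)[h
  hF hg]].
  suff -> : g' = e by []; apply: val_inj; rewrite g'e euv setUC //.
have <- : h = g' by exact: val_inj.
by move: hF; rewrite in_setD1 => /andP[].
Qed.

End Cycles.

(** * Concentration over the random partition *)

Section PartConcentration.
Variables (R : realType) (V : finType) (E : {set {set V}}) (eta : nat).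
Hypothesis eta_gt0 : (0 < eta)%N.
Local Notation J := 'I_eta.
Local Notation wJ := (@uniform_pmf R J).
Local Notation w := (iid_pmf wJ : {ffun edge E -> J} -> R).
Implicit Types (om : {ffun edge E -> J}) (u : V) (j : J).

Definition part om j : {set edge E} := [set e | om e == j].

Lemma part_pmfP : pmf w.
Proof. by apply/iid_pmfP/uniform_pmfP; rewrite card_ord. Qed.

(** Each member arises from some walk, and the walks of length [m] number at most the [m]-th power
    of the maximum degree. *)
Lemma sum_short_cycles (y : R) N u : 0 <= y ->
  \sum_(C in short_cycles E N u) y ^+ #|C| <=
  \sum_(m < N.+1 | (1 < m)%N) (max_degree [set: edge E])%:R ^+ m * y ^+ m.+1.
Proof.
move=> y0.
pose hit (C : {set edge E}) m p := (C == cycle_edges E u p) && (#|C| == m.+1).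
apply: (@le_trans _ _ (\sum_(C in short_cycles E N u) \sum_(m < N.+1 | (1 <
  m)%N)
    \sum_(p <- walks E m u | hit C m p) y ^+ m.+1)).
  apply: ler_sum => C; rewrite inE => /existsP[m /andP[m1 /hasP[p pW /andP[Cp
    Cm]]]].
  have nn (k : nat) : 0 <= \sum_(p <- walks E k u | hit C k p) y ^+ k.+1.
    by apply: sumr_ge0 => p' _; rewrite exprn_ge0.
  rewrite (bigD1 m) //= ler_wpDr ?sumr_ge0 // (big_rem p) //= /hit Cp Cm.
  by rewrite (eqP Cm) lerDl sumr_ge0 // => p' _; rewrite exprn_ge0.
rewrite exchange_big /=; apply: ler_sum => m m1.
under eq_bigr do rewrite big_mkcond.
rewrite exchange_big /=.
apply: (@le_trans _ _ (\sum_(p <- walks E m u) y ^+ m.+1)).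
  apply: ler_sum => p _.
  apply: (@le_trans _ _ (\sum_(C | C == cycle_edges E u p) y ^+ m.+1));
    last first.
    by rewrite big_pred1_eq.
  rewrite big_mkcond [leRHS]big_mkcond; apply: ler_sum => C _ /=.
  rewrite /hit; case: (C == cycle_edges E u p) => /=; last by case: ifP.
  by case: ifP => _; rewrite ?exprn_ge0 //; case: ifP => _; rewrite ?exprn_ge0.
rewrite big_const_seq count_predT iter_addr_0 -[leLHS]mulr_natl.
rewrite ler_wpM2r ?exprn_ge0 // -natrX ler_nat.
exact: size_walks.
Qed.

Definition has_short_cycle N om u j :=
  [exists C in short_cycles E N u, C \subset part om j].

(** Markov's inequality for the exponential moment. With x the sum over short cycles, the factor of
    one part is at most 1 + (e^t - 1) times the number of short cycles in it, and the moment is at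
    most (1 + (e^t - 1) x)^eta, hence at most e^eta. *)
Lemma prob_many_short_cycles (y t M : R) N u : 0 <= t -> y = eta%:R^-1 ->
  expR t * \sum_(C in short_cycles E N u) y ^+ #|C| <= 1 ->
  prob w (fun om => M < #|[set j | has_short_cycle N om u j]|%:R) <=
  expR (eta%:R - t * M).
Proof.
move=> t0 yE tx; have z0 : 0 <= expR t - 1 by rewrite subr_ge0 -expR0 ler_expR.
have y0 : 0 <= y by rewrite yE invr_ge0.
(* The empty set occurs in every part and supplies the summand 1. *)
pose a (C : {set edge E}) : R :=
  if C == set0 then 1 else if C \in short_cycles E N u then expR t - 1 else 0.
have a0 C : 0 <= a C by rewrite /a; case: ifP => // _; case: ifP.
have nE : set0 \notin short_cycles E N u.
  rewrite inE; apply/existsP => -[m /andP[_ /hasP[p _ /andP[_]]]].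
  by rewrite cards0.
have aE (F : {set edge E} -> R) : \sum_C a C * F C =
    F set0 + (expR t - 1) * \sum_(C in short_cycles E N u) F C.
  rewrite (bigD1 set0) //= {1}/a eqxx mul1r; congr (_ + _).
  rewrite mulr_sumr [RHS]big_mkcond [LHS]big_mkcond; apply: eq_bigr => C _ /=.
  rewrite /a; case: (eqVneq C set0) => [->|C0] /=; first by rewrite (negPf nE).
  by case: ifP; rewrite ?mul0r.
have J0 : (0 < #|J|)%N by rewrite card_ord.
have wP := part_pmfP.
apply: (@le_trans _ _ (expR (- (t * M)) * expect w (fun om =>
   \prod_j \sum_C a C * ([forall e in C, om e == j])%:R))).
  rewrite -expectZ; apply: prob_markov => // om.
    rewrite mulr_ge0 ?expR_ge0 // prodr_ge0 // => j _.
    by rewrite sumr_ge0 // => C _; rewrite mulr_ge0.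
  move=> many; apply: (@le_trans _ _ (expR (- (t * M)) *
      \prod_j (if has_short_cycle N om u j then expR t else 1))).
    rewrite -big_mkcond -expR_sum -expRD sumr_const -[t *+ _]mulr_natr
      -[leLHS]expR0.
    rewrite ler_expR; have := ler_wpM2l t0 (ltW many).
    by rewrite cardsE; lra.
  rewrite ler_wpM2l ?expR_ge0 //; apply: ler_prod => j _; apply/andP; split.
    by case: ifP; rewrite ?expR_ge0.
  rewrite aE; have -> : [forall e in set0, om e == j].
    by apply/forallP => e; rewrite inE.
  have s0 : 0 <= \sum_(C in short_cycles E N u) ([forall e in C, om e ==
    j])%:R :> R.
    by apply: sumr_ge0 => C _; rewrite ler0n.
  case: ifP => [/existsP[C /andP[CS Csub]]|_]; last by rewrite lerDl mulr_ge0.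
  rewrite (bigD1 C) //=; have -> : [forall e in C, om e == j].
    by apply/forallP => e; apply/implyP => eC; have := subsetP Csub e eC;
      rewrite inE.
  set r := \sum_(_ | _) _; have r0 : 0 <= r by apply: sumr_ge0 => C' _;
    rewrite ler0n.
  by have := mulr_ge0 z0 r0; rewrite /=; lra.
rewrite expRD mulrC ler_wpM2r ?expR_ge0 //.
apply: le_trans (expect_prod_occurrence _ a0 J0) _.
rewrite card_ord -yE aE cards0 expr0 -[eta%:R]mulr1 expRM_natl.
set x := \sum_(C in _) _ in tx *.
have x0 : 0 <= x by apply: sumr_ge0 => C _; rewrite exprn_ge0.
rewrite lerXn2r ?nnegrE ?addr_ge0 ?mulr_ge0 ?expR_ge0 //.
apply: le_trans (expR_ge1Dx _) _; rewrite ler_expR; lra.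
Qed.

(** Chernoff's bound with parameter [eps]: the exponent is at most (e^eps - 1) d - eps (1 + eps)
    d. *)
Lemma prob_large_degree (eps d : R) (S : {set edge E}) j :
  0 < eps < 1 / 10 -> #|S|%:R <= d * eta%:R ->
  prob w (fun om => (1 + eps) * d < #|[set e in S | om e == j]|%:R) <=
  expR (- (33 / 100 * eps ^+ 2 * d)).
Proof.
move=> /andP[e0 e1] Sd.
have wP := part_pmfP.
have J0 : (0 < #|J|)%N by rewrite card_ord.
have eta0 : 0 < eta%:R :> R by rewrite ltr0n.
have d0 : 0 <= d.
  by rewrite -(pmulr_lge0 _ eta0); apply: le_trans Sd; rewrite ler0n.
(* This follows from (1 - eps/4)^4 <= e^(- eps). The excess of 67/100 over 1/2 pays for the
   approximation; the distance from 1 is the final 33/100. *)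
have expe : expR eps <= 1 + eps + 67 / 100 * eps ^+ 2.
  pose x := eps / 4.
  have h : 1 - x <= expR (- x) by exact: expR_ge1Dx.
  have x0 : 0 < 1 - x by rewrite /x; lra.
  have h4 : (1 - x) ^+ 4 <= expR (- eps).
    have -> : - eps = 4%:R * - x by rewrite /x; field.
    by rewrite expRM_natl lerXn2r // nnegrE ?expR_ge0 // ltW.
  have := expRxMexpNx_1 eps; have := expR_gt0 eps => ee0 ee.
  have : (1 - x) ^+ 4 * (1 + eps + 67 / 100 * eps ^+ 2) >= 1.
    have -> : eps = 4 * x by rewrite /x; field.
    have : 0 < x <= 1 / 40 by rewrite /x; apply/andP; split; lra.
    move: (x) => z /andP[z0 z1].
    have -> : (1 - z) ^+ 4 * (1 + 4 * z + 67 / 100 * (4 * z) ^+ 2) =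
      1 + z ^+ 2 * ((72 - 2288 * z) / 100 + z ^+ 2 * (4932 / 100 - 3888 / 100
        * z
         + 1072 / 100 * z ^+ 2)) by field.
    rewrite lerDl mulr_ge0 ?sqr_ge0 // addr_ge0 //; first lra.
    rewrite mulr_ge0 ?sqr_ge0 //; have := sqr_ge0 z; lra.
  have A0 : 0 < 1 + eps + 67 / 100 * eps ^+ 2 by have := sqr_ge0 eps; lra.
  move=> /le_trans /(_ (ler_wpM2r (ltW A0) h4)).
  move=> h1; rewrite -(ler_pM2l (expR_gt0 (- eps))).
  by rewrite mulrC ee.
apply: (@le_trans _ _ (expR (- (eps * ((1 + eps) * d))) * expect w (fun om =>
   \prod_e expR (if (e \in S) && (om e == j) then eps else 0)))).
  rewrite -expectZ; apply: prob_markov => // om.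
    by rewrite mulr_ge0 ?expR_ge0 // prodr_ge0 // => e _; rewrite expR_ge0.
  move=> large; rewrite -expR_sum -big_mkcond sumr_const -expRD -[leLHS]expR0
    ler_expR.
  rewrite -[eps *+ _]mulr_natr.
  have := ler_wpM2l (ltW e0) (ltW large).
  by rewrite cardsE; lra.
rewrite (expect_iid_prod _ (fun e c => expR (if (e \in S) && (c == j) then eps
  else 0))).
have E1 e : expect wJ (fun c => expR (if (e \in S) && (c == j) then eps else
  0)) =
    1 + (if e \in S then (expR eps - 1) / eta%:R else 0).
  case: (e \in S) => /=; last by rewrite expR0 expect_cst ?addr0 //;
    exact: uniform_pmfP.
  rewrite (eq_expect _ (G := fun c => 1 + (expR eps - 1) * (pred1 j c)%:R)).
    rewrite expectD expect_cst; last exact: uniform_pmfP.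
    by rewrite expectZ -prob_expect /prob big_pred1_eq /uniform_pmf card_ord.
  by move=> c /=; case: (c == j); rewrite ?mulr1 ?mulr0 ?addr0 ?expR0
    // addrC subrK.
apply: (@le_trans _ _ (expR (- (eps * ((1 + eps) * d))) *
   \prod_e expR (if e \in S then (expR eps - 1) / eta%:R else 0))).
  rewrite ler_wpM2l ?expR_ge0 //; apply: ler_prod => e _.
  rewrite {2}E1 expR_ge1Dx andbT; apply: expect_ge0; first exact: uniform_pmfP.
  by move=> c; rewrite expR_ge0.
rewrite -expR_sum -big_mkcond sumr_const -expRD ler_expR -[_ *+ _]mulr_natr.
have z0 : 0 <= expR eps - 1 by rewrite subr_ge0 -expR0 ler_expR ltW.
have h1 : (expR eps - 1) / eta%:R * #|S|%:R <= (expR eps - 1) * d.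
  by rewrite -mulrA ler_wpM2l // mulrC ler_pdivrMr.
have h2 : (expR eps - 1) * d <= (eps + 67 / 100 * eps ^+ 2) * d.
  by rewrite ler_wpM2r //; lra.
by move: h1 h2; lra.
Qed.

End PartConcentration.

(** * Failed edges at a vertex *)

Section FailedDegree.
Variables (R : realType) (V : finType) (E : {set {set V}}) (eps D : R) (eta :
  nat).
Variable om : {ffun edge E -> 'I_eta}.
Local Notation T := (nrounds eps).
Local Notation q := (palette_size eps D).
Local Notation seed := (nibble_seed E eps D).
Local Notation w := (@nibble_pmf R V E eps D).
Local Notation N := (T.*2).+1.
Implicit Types (s : seed) (sd : {ffun 'I_eta -> seed}) (u : V) (j : 'I_eta).

Hypothesis E_simple : simple_graph E.
Hypothesis eps01 : 0 < eps < 1 / 10.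
Hypothesis D_ge : 8 / eps ^+ 3 <= D.
Hypothesis q_ge : (1 + eps) * D <= q%:R.
Hypothesis q_le : q%:R <= 2 * D.
Hypothesis part_deg_le : forall u j,
  #|[set e in part om j | incident u e]|%:R <= D.

Definition failed_at s u j : {set edge E} :=
  [set e in nibble_failed (part om j) s | incident u e].

Lemma failed_at_le s u j :
  (#|failed_at s u j| <= #|[set e in part om j | incident u e]|)%N.
Proof.
apply/subset_leq_card/subsetP => e; rewrite !in_set.
by case/andP=> /andP[-> _] ->.
Qed.

(** By linearity, over the edges of the part at [u]; an edge near both ends of one of them would
    close a short cycle through [u]. *)
Lemma expect_failed_at u j : ~~ has_short_cycle N om u j ->
  expect w (fun s => #|failed_at s u j|%:R) <=
  6 * eps * #|[set e in part om j | incident u e]|%:R.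
Proof.
move=> nocycle; set S := [set e in _ | _].
have q0 : (0 < q)%N := ltnW (q_gt1 eps01 D_ge q_ge).
have wP : pmf w by apply: nibble_pmfP => //; case/andP: eps01 => -> ?;
  rewrite /=; lra.
have -> : expect w (fun s => #|failed_at s u j|%:R) =
    \sum_(e in S) prob w (fun s => e \in nibble_failed (part om j) s).
  under [RHS]eq_bigr do rewrite prob_expect.
  rewrite -expect_sum; apply: eq_expect => s.
  rewrite -natr_sum; congr _%:R; rewrite -sum1_card big_mkcond [RHS]big_mkcond.
  apply: eq_bigr => e _; rewrite !in_set; case: (incident u e);
    rewrite ?andbF ?andbT //.
  by case: (om e == j) => //=; case: [|| _, _ | _].
rewrite mulr_natr -sumr_const; apply: ler_sum => e;
  rewrite in_set => /andP[eF ue].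
have [v euv] : exists v, val e = [set u; v].
  have /eqP/cards2P[x [y [xy exy]]] := E_simple (valP e).
  move: ue; rewrite /incident exy in_set2 => /orP[]/eqP ->; first by exists y.
  by exists x; rewrite setUC.
apply: (prob_edge_failed eps01 D_ge q_ge q_le _ eF euv) => [x|g gF];
  first exact: part_deg_le.
apply: contra nocycle => /andP[ug vg].
have [C Cc CF] := short_cycles_touches E_simple eF euv gF ug vg.
by apply/existsP; exists C; rewrite Cc.
Qed.

(** The parts are independent given [om]. Divided by [2 * D], each count is some z <= 1/2, where e^z
    <= 1 + 2z. The logarithm of the moment is then at most 6 eps Delta / D, against the scaled
    threshold 17/2 eps Delta / D; the difference is 5/2. *)
Lemma prob_failed_sum (Delta : R) u :
  #|[set e : edge E | incident u e]|%:R <= Delta ->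
  prob (iid_pmf w) (fun sd =>
    17 * eps * Delta <
    \sum_(j | ~~ has_short_cycle N om u j) #|failed_at (sd j) u j|%:R) <=
  expR (- (5 / 2 * eps * Delta / D)).
Proof.
move=> degD; case/andP: (eps01) => e0 e1.
have q0 : (0 < q)%N := ltnW (q_gt1 eps01 D_ge q_ge).
have wP : pmf w by apply: nibble_pmfP => //; rewrite e0 /=; lra.
have D0 : 0 < D by have := D_gt eps01 D_ge; lra.
pose x j s : R := if has_short_cycle N om u j then 0 else #|failed_at s u
  j|%:R / (2 * D).
pose d j : R := #|[set e in part om j | incident u e]|%:R.
have x0 j s : 0 <= x j s <= 1 / 2.
  rewrite /x; case: ifP => _; first by rewrite lexx; lra.
  apply/andP; split; first by rewrite divr_ge0 ?ler0n // mulr_ge0 // ltW.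
  rewrite ler_pdivrMr ?mulr_gt0 //.
  have : #|failed_at s u j|%:R <= d j by rewrite ler_nat failed_at_le.
  by have := part_deg_le u j; rewrite -/(d j); lra.
pose t := 17 * eps * Delta / (2 * D).
apply: (@le_trans _ _ (expR (- t) * expect (iid_pmf w) (fun sd =>
    \prod_j expR (x j (sd j))))).
  rewrite -expectZ; apply: prob_markov => [|sd|sd].
  - exact: iid_pmfP.
  - by rewrite mulr_ge0 ?expR_ge0 // prodr_ge0 // => j _; rewrite expR_ge0.
  move=> large; rewrite -expR_sum -expRD -[leLHS]expR0 ler_expR.
  have -> : \sum_j x j (sd j) =
     (\sum_(j | ~~ has_short_cycle N om u j) #|failed_at (sd j) u j|%:R) / (2
       * D).
    rewrite mulr_suml [RHS]big_mkcond; apply: eq_bigr => j _.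
    by rewrite /x; case: has_short_cycle.
  by rewrite addrC subr_ge0 ler_pM2r ?invr_gt0 ?mulr_gt0 // ltW.
rewrite (expect_iid_prod _ (fun j s => expR (x j s))).
apply: (@le_trans _ _ (expR (- t) * \prod_j expR (6 * eps * d j / D))).
  rewrite ler_wpM2l ?expR_ge0 //; apply: ler_prod => j _; apply/andP; split.
    by apply: expect_ge0 => // s; rewrite expR_ge0.
  apply: (@le_trans _ _ (expect w (fun s => 1 + 2 * x j s))).
    apply: ler_expect => // s; case/andP: (x0 j s) => z0 z1.
    move: (x j s) z0 z1 => z z0 z1.
    have := expRxMexpNx_1 z; have := expR_ge1Dx (- z); have := expR_gt0 z.
    by move: (expR z) (expR (- z)) => a b a0 b1 ab; nra.
  rewrite expectD expect_cst // expectZ; apply: le_trans (expR_ge1Dx _).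
  rewrite lerD2l /x; case: (boolP (has_short_cycle _ _ _ _)) => [_|nc].
    by rewrite expect_cst // mulr0 divr_ge0 ?mulr_ge0 ?ler0n //; lra.
  rewrite (eq_expect _ (G := fun s => (2 * D)^-1 * #|failed_at s u j|%:R)).
    rewrite expectZ mulrA ler_pdivlMr // -/(d j).
    have := expect_failed_at nc; rewrite -/(d j) => h.
    apply: le_trans h; rewrite le_eqVlt; apply/orP; left; apply/eqP.
    by field; rewrite lt0r_neq0.
  by move=> s; rewrite mulrC.
rewrite -expR_sum -expRD ler_expR.
have -> : \sum_j 6 * eps * d j / D = 6 * eps / D * \sum_j d j.
  by rewrite mulr_sumr; apply: eq_bigr => j _; rewrite mulrAC.
have -> : \sum_j d j = #|[set e : edge E | incident u e]|%:R.
  rewrite /d -natr_sum; congr _%:R; rewrite -[RHS]sum1_card.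
  rewrite (partition_big om xpredT) //=; apply: eq_bigr => j _.
  by rewrite -sum1_card; apply: eq_bigl => e; rewrite !in_set andbC.
have c0 : 0 <= 6 * eps / D by rewrite divr_ge0 ?mulr_ge0 // ltW.
have := ler_wpM2l c0 degD.
have -> : t = 17 / 2 * eps * Delta / D by rewrite /t; field; rewrite lt0r_neq0.
move: D0 => _; lra.
Qed.

End FailedDegree.

(** * The greedy phase *)

Section Greedy.
Variables (V : finType) (E : {set {set V}}) (g : greedy_rule E).
Hypothesis E_simple : simple_graph E.
Variable H : {set edge E}.
Local Notation k := (3 * max_degree H)%N.
Implicit Types (e f : edge E) (chi : edge E -> option nat) (s : seq (edge E)).

Lemma adjacent_sym e f : adjacent e f = adjacent f e.
Proof.
by rewrite /adjacent eq_sym; congr andb; apply: eq_existsb => u; rewrite andbC.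
Qed.

(** Two ends give at most [2 * max_degree H] neighbors, and [e] itself makes the maximum degree
    positive, so three times it is strictly more. *)
Lemma card_adjacent e : e \in H -> (#|[set f in H | adjacent f e]| < k)%N.
Proof.
move=> eH.
have /eqP/cards2P[x [y [xy exy]]] := E_simple (valP e).
pose S z := [set f in H | incident z f].
have S_le z : (#|S z| <= max_degree H)%N by apply: (leq_bigmax z).
have pos : (0 < max_degree H)%N.
  apply: leq_trans (S_le x); apply/card_gt0P; exists e.
  by rewrite in_set eH /incident exy in_set2 eqxx.
have sub : [set f in H | adjacent f e] \subset S x :|: S y.
  apply/subsetP => f; rewrite !in_set => /andP[-> /andP[_ /existsP[z
    /andP[zf]]]].
  by rewrite /incident exy in_set2 => /orP[]/eqP <-;
    rewrite -/(incident z f) zf ?orbT.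
have := subset_leq_card sub; have := (leq_card_setU (S x) (S y)).1.
have := S_le x; have := S_le y; lia.
Qed.

Definition greedy_inv s chi :=
  [/\ forall e, e \notin s -> chi e = None,
      forall e, e \in s -> exists2 c, chi e = Some c & (c < k)%N &
      forall e f, e \in s -> f \in s -> adjacent e f -> chi e != chi f].

(** Otherwise all [k] colors would occur among the colored neighbors of [e], which are fewer than
    [k]. *)
Lemma available_neq_nil s chi e : {subset s <= H} -> greedy_inv s chi ->
  e \in H -> available k chi e != [::].
Proof.
move=> sH [inv0 _ _] eH; apply/eqP => none.
have : (k <= size (pmap chi (enum [set f in H | adjacent f e])))%N.
  rewrite -[X in (X <= _)%N](size_iota 0); apply: uniq_leq_size;
    first exact: iota_uniq.
  move=> c ck; rewrite mem_pmap; apply/mapP.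
  have : c \notin available k chi e by rewrite none.
  rewrite mem_filter ck andbT negb_forall => /existsP[f].
  rewrite negb_imply negbK => /andP[fe /eqP fc]; exists f => //.
  rewrite mem_enum in_set fe andbT; apply: sH; apply: contraT => /inv0.
  by rewrite fc.
rewrite size_pmap => /leq_trans/(_ (count_size _ _)).
by rewrite -cardE leqNgt card_adjacent.
Qed.

Lemma greedy_inv_step s chi e : {subset s <= H} -> greedy_inv s chi ->
  e \in H -> e \notin s -> greedy_inv (e :: s) (greedy_step g k H chi e).
Proof.
move=> sH inv eH es; have av := available_neq_nil sH inv eH.
have [inv0 inv1 inv2] := inv.
rewrite /greedy_step; set A := available k chi e in av *.
set c := pick_color g H e A.
have cA : c \in A by exact: pick_color_in.
have -> : (fun f => if f == e then if A is [::] then None else Some c else chi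
  f)
  =  (fun f => if f == e then Some c else chi f) by case: (A) av.
have cN f : adjacent f e -> chi f != Some c.
  by move: cA; rewrite mem_filter => /andP[/forallP/(_ f)/implyP].
have ck : (c < k)%N by move: cA; rewrite mem_filter mem_iota => /and3P[].
have adjN f : adjacent f f = false by rewrite /adjacent eqxx.
split=> [f|f|f f'].
- by rewrite in_cons negb_or => /andP[/negPf -> /inv0].
- by rewrite in_cons; case: eqP => [_ _|_ /inv1 //]; exists c.
rewrite !in_cons; case: (eqVneq f e) => [->|fe] /=;
  case: (eqVneq f' e) => [->|fe'] //=.
- by rewrite adjN.
- by move=> _ _ ef; rewrite eq_sym; apply: cN; rewrite adjacent_sym.
- by move=> _ _ /cN.
- exact: inv2.
Qed.

Lemma greedy_proper : greedy_inv (enum H) (greedy g k H).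
Proof.
have ord := order_perm g H.
suff : greedy_inv (Defs.order g H) (greedy g k H).
  move=> [i0 i1 i2]; split=> [e|e|e f]; rewrite -!(perm_mem ord);
    [exact: i0|exact: i1|exact: i2].
have ordH : {subset Defs.order g H <= H} by move=> e;
  rewrite (perm_mem ord) mem_enum.
have ordU : uniq (Defs.order g H) by rewrite (perm_uniq ord) enum_uniq.
(* Generalized to a fold that starts with the edges of [s] already colored; each processed edge goes
   to the front, hence [rev r ++ s]. *)
suff fold s r chi : {subset s <= H} -> {subset r <= H} -> uniq r ->
    (forall e, e \in r -> e \notin s) -> greedy_inv s chi ->
    greedy_inv (rev r ++ s) (foldl (greedy_step g k H) chi r).
  have := @fold [::] (Defs.order g H) (fun=> None) _ ordH ordU _ _.
  rewrite cats0 => h; have [] : greedy_inv (rev (Defs.order g H)) (greedy g k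
    H) by exact: h.
  by move=> i0 i1 i2; split=> [e|e|e f]; rewrite -!(mem_rev (Defs.order g H));
    [exact: i0|exact: i1|exact: i2].
elim: r s chi => //= e r IH s chi sH rH /andP[er rU] rs inv.
rewrite rev_cons cat_rcons; apply: IH => //.
- by move=> f; rewrite in_cons => /orP[/eqP ->|/sH //]; apply: rH;
  rewrite mem_head.
- by move=> f fr; apply: rH; rewrite in_cons fr orbT.
- move=> f fr; rewrite in_cons negb_or rs ?in_cons ?fr ?orbT // andbT.
  by apply: contraNneq er => <-.
- apply: greedy_inv_step => //; first by apply: rH; rewrite mem_head.
  by apply: rs; rewrite mem_head.
Qed.

End Greedy.

(** * StaticColor *)

Section StaticColoring.
Variables (R : realType) (V : finType) (E : {set {set V}}) (eps Delta : R).
Variables (g : greedy_rule E) (omega : static_seed E eps Delta).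
Hypothesis E_simple : simple_graph E.
Local Notation eta := (nparts eps Delta).
Local Notation q := (palette_size eps (part_bound eps Delta)).
Local Notation F := (all_failed omega).

Lemma static_color_failed (e : edge E) : e \in F ->
  exists c, [/\ static_color g omega e = Some (eta * q + c)%N,
    greedy g (3 * max_degree F) F e = Some c & (c < 3 * max_degree F)%N].
Proof.
move=> eF; have [_ inv _] := greedy_proper g E_simple F.
have [|c gc ck] := inv e; first by rewrite mem_enum.
by exists c; rewrite /static_color eF gc.
Qed.

Lemma not_failed (e : edge E) : e \notin F ->
  e \notin nibble_failed (subgraph omega (omega.1 e)) (omega.2 (omega.1 e)).
Proof. by apply: contra => eN; apply/bigcupP; exists (omega.1 e). Qed.

Lemma static_color_kept (e : edge E) : e \notin F ->
  exists c : 'I_q, static_color g omega e = Some (omega.1 e * q + c)%N /\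
    tentative (subgraph omega (omega.1 e)) (omega.2 (omega.1 e)) e = Some c.
Proof.
move=> eF; have := not_failed eF; rewrite in_set negb_and !negb_or.
rewrite in_set eqxx /= /static_color (negPf eF).
by case: (tentative _ _ _) => [c _|]; [exists c | rewrite eqxx !andbF].
Qed.

Lemma static_color_proper K : (eta * q + 3 * max_degree F <= K)%N ->
  proper_edge_coloring K (static_color g omega).
Proof.
move=> leK.
(* The blocks of the runs stay below [eta * q], where the greedy colors begin. *)
have block (j : 'I_eta) (c : 'I_q) : (j * q + c < eta * q)%N.
  have := ltn_ord j; have := ltn_ord c; nia.
apply/andP; split.
  apply/forallP => e; case: (boolP (e \in F)) => eF.
    have [c [-> _ ck]] := static_color_failed eF.
    by apply: leq_trans leK; rewrite -addnS leq_add2l.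
  have [c [-> _]] := static_color_kept eF.
  by apply: leq_trans (block _ _) (leq_trans (leq_addr _ _) leK).
apply/forallP => e; apply/forallP => f; apply/implyP => ef.
have cross c (j : 'I_eta) (b : 'I_q) : Some (eta * q + c)%N != Some (j * q +
  b)%N.
  apply/eqP => -[h]; have := block j b; rewrite -h; lia.
case: (boolP (e \in F)) => eF; case: (boolP (f \in F)) => fF.
- have [c [-> ec _]] := static_color_failed eF.
  have [b [-> fb _]] := static_color_failed fF.
  have [_ _ inv] := greedy_proper g E_simple F.
  have := inv e f; rewrite !mem_enum ec fb => /(_ eF fF ef).
  by rewrite !(inj_eq Some_inj) eqn_add2l.
- have [c [-> _ _]] := static_color_failed eF.
  by have [b [-> _]] := static_color_kept fF.
- have [c [-> _ _]] := static_color_failed fF.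
  by have [b [-> _]] := static_color_kept eF; rewrite eq_sym.
have [c [-> ec]] := static_color_kept eF.
have [b [-> fb]] := static_color_kept fF.
have cq := ltn_ord c; have bq := ltn_ord b.
apply/eqP => -[h].
(* Division by [q] recovers the part from the color. *)
have jj : omega.1 e = omega.1 f.
  apply: val_inj; have := congr1 (fun x => x %/ q)%N h.
  by rewrite !divnMDl ?divn_small ?addn0 //; lia.
have cb : c = b by apply: val_inj; move: h; rewrite jj => /addnI.
have fN := not_failed fF; rewrite -jj in fN fb.
have [||_ _] := nibble_failedN_inj _ _ ef (not_failed eF) fN.
- by rewrite in_set.
- by rewrite in_set jj.
by rewrite ec fb cb eqxx.
Qed.

(** In the parts selected by [B] every edge at [u] is counted as if it failed. *)
Lemma degree_all_failed (B : pred 'I_eta) (D : R) u :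
  (forall j, #|[set e in part omega.1 j | incident u e]|%:R <= D) ->
  #|[set e in F | incident u e]|%:R <=
   \sum_(j | ~~ B j) #|failed_at omega.1 (omega.2 j) u j|%:R
   + #|[set j | B j]|%:R * D.
Proof.
move=> degD.
apply: (@le_trans _ _ (\sum_j #|failed_at omega.1 (omega.2 j) u j|%:R)).
  rewrite -natr_sum ler_nat -sum1_card (partition_big omega.1 xpredT) //=.
  apply: leq_sum => j _; rewrite sum1dep_card;
    apply/subset_leq_card/subsetP => e.
  rewrite !in_set => /andP[/andP[/bigcupP[j' _ eN] ue] /eqP ej].
  have j'j : j' = j by move: eN; rewrite !in_set ej => /andP[/eqP].
  by rewrite ue andbT; move: eN; rewrite j'j !in_set.
rewrite (bigID B) /= addrC lerD2l mulr_natl -sumr_const big_mkcond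
  [leRHS]big_mkcond.
apply: ler_sum => j _; rewrite in_set; case: (B j) => //.
by apply: le_trans (degD j); rewrite ler_nat failed_at_le.
Qed.

End StaticColoring.

(** * Choice of parameters and the three bad events *)

Section StaticColorBound.
Variables (R : realType) (V : finType) (E : {set {set V}}) (eps Delta : R).
Local Notation T := (nrounds eps).
Local Notation d := (Delta' eps Delta).
Local Notation D := (part_bound eps Delta).
Local Notation q := (palette_size eps D).
Local Notation eta := (nparts eps Delta).
Local Notation l := (ln #|V|%:R : R).

Hypothesis eps01 : 0 < eps < 1 / 10.
Hypothesis E_simple : simple_graph E.
Hypothesis Delta_ge : (100 * l / eps ^+ 4) `^ (30 / eps * ln eps^-1) <= Delta.
Hypothesis deg_le_Delta : (max_degree [set: edge E])%:R <= Delta.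
Hypothesis V_gt1 : (1 < #|V|)%N.

Lemma eps_gt0 : 0 < eps. Proof. by case/andP: eps01. Qed.
Lemma eps_lt : eps < 1 / 10. Proof. by case/andP: eps01. Qed.
Hint Resolve eps_gt0 : core.

Lemma expR_half_le2 : expR (1 / 2) <= 2 :> R.
Proof.
have := expR_ge1Dx (- (1 / 2) : R); have := expRxMexpNx_1 (1 / 2 : R).
have := expR_gt0 (1 / 2 : R); move: (expR _) (expR _) => a b; nra.
Qed.

Lemma ln_card_ge : 1 / 2 <= l.
Proof.
rewrite -ler_expR lnK ?posrE ?ltr0n; last by lia.
by apply: le_trans expR_half_le2 _; rewrite ler_nat.
Qed.

(** The surplus of 1/10 over 1 absorbs the rounding of [T], so that T >= 1/eps. *)
Lemma ln_epsV_ge : 11 / 10 <= ln eps^-1.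
Proof.
have h : 9 / 20 <= expR (- (11 / 20)) :> R.
  by apply: le_trans (expR_ge1Dx _); lra.
rewrite lnV ?posrE // lerNr -ler_expR lnK ?posrE //.
have -> : - (11 / 10) = 2%:R * - (11 / 20) :> R by field.
rewrite expRM_natl; apply: (@le_trans _ _ ((9 / 20) ^+ 2)).
  by have := eps_lt; rewrite expr2; lra.
by rewrite lerXn2r // nnegrE ?expR_ge0 //; lra.
Qed.

Lemma ln_epsV_le : ln eps^-1 <= eps^-1.
Proof.
have i0 : 0 < eps^-1 by rewrite invr_gt0.
have h : ln (1 + (eps^-1 - 1)) <= eps^-1 - 1 by apply: le_ln1Dx; lra.
by move: h; rewrite addrCA subrr addr0; lra.
Qed.

Lemma nrounds_ge : eps^-1 <= T%:R.
Proof.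
have i10 : 10 <= eps^-1.
  by rewrite -[eps^-1]mul1r ler_pdivlMr //; have := eps_lt; lra.
have i0 : 0 <= eps^-1 by lra.
by have := nrounds_gt eps; have := ler_wpM2l i0 ln_epsV_ge; lra.
Qed.

Lemma nrounds_le : T%:R <= eps^-1 * ln eps^-1.
Proof.
have i0 : 0 < eps^-1 by rewrite invr_gt0.
have L0 := ln_epsV_ge.
have /truncn_itv/andP[] // : 0 <= eps^-1 * ln eps^-1.
by rewrite mulr_ge0 // ?(ltW i0) //; lra.
Qed.

Lemma nrounds_sqr_le : eps ^+ 2 * T%:R <= 1.
Proof.
apply: (@le_trans _ _ (eps ^+ 2 * (eps^-1 * eps^-1))).
  rewrite ler_wpM2l ?sqr_ge0 // (le_trans nrounds_le) //.
  by rewrite ler_wpM2l ?ln_epsV_le // invr_ge0 ltW.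
by rewrite le_eqVlt; apply/orP; left; apply/eqP; field; rewrite lt0r_neq0.
Qed.

Lemma nrounds_gt10 : (10 <= T)%N.
Proof.
rewrite -(ler_nat R); apply: le_trans nrounds_ge.
by rewrite -[eps^-1]mul1r ler_pdivlMr //; have := eps_lt; lra.
Qed.

Lemma T30_gt0 : 0 < 30 * T%:R :> R.
Proof. by rewrite mulr_gt0 ?ltr0n //; have := nrounds_gt10; lia. Qed.

Lemma Delta_ge0 : 0 <= Delta.
Proof. exact: le_trans (powR_ge0 _ _) Delta_ge. Qed.

Lemma eps4_gt0 : 0 < eps ^+ 4. Proof. by rewrite exprn_gt0. Qed.

(** Each power of [eps] given up gains a factor 10; applied repeatedly to the bound on
    [d * eps ^+ 4]. *)
Lemma eps_expr_ge (a x : R) k : 0 < x -> a <= x * eps ^+ k.+1 ->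
  10 * a <= x * eps ^+ k.
Proof.
move=> x0; have xk : 0 < x * eps ^+ k by rewrite mulr_gt0 ?exprn_gt0.
have := ler_wpM2l (ltW xk) (ltW eps_lt); rewrite exprSr mulrA; lra.
Qed.

(** The root of order 30 T of the hypothesis on [Delta]: its base is at least 1, and its exponent is
    at least 30 T because [T] is rounded down. *)
Lemma Delta'_ge : 100 * l / eps ^+ 4 <= d.
Proof.
set B := 100 * l / eps ^+ 4.
have l0 := ln_card_ge.
have B1 : 1 <= B.
  rewrite ler_pdivlMr ?eps4_gt0 // mul1r.
  apply: (@le_trans _ _ 1); last by lra.
  by rewrite exprn_ile1 //; [exact: ltW | have := eps_lt; lra].
have BT : B `^ (30 * T%:R) <= Delta.
  apply: le_trans Delta_ge; apply: ler_powR => //.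
  by rewrite -mulrA ler_wpM2l // nrounds_le.
have -> : B = (B `^ (30 * T%:R)) `^ (30 * T%:R)^-1.
  by rewrite -powRrM mulfV ?lt0r_neq0 ?T30_gt0 // powRr1 // (le_trans ler01).
apply: ge0_ler_powR => //; first by rewrite invr_ge0 ltW ?T30_gt0.
  by rewrite nnegrE powR_ge0.
by rewrite nnegrE Delta_ge0.
Qed.

Lemma Delta'_expr : d ^+ (30 * T) = Delta.
Proof.
rewrite -powR_mulrn ?powR_ge0 // -powRrM natrM mulVf ?lt0r_neq0 ?T30_gt0 //.
exact: powRr1 Delta_ge0.
Qed.

Lemma Delta'_eps4 : 100 * l <= d * eps ^+ 4.
Proof. by rewrite -ler_pdivrMr ?eps4_gt0 // Delta'_ge. Qed.

Lemma Delta'_gt0 : 0 < d.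
Proof.
apply: lt_le_trans Delta'_ge; rewrite divr_gt0 ?eps4_gt0 //.
have := ln_card_ge; lra.
Qed.

Lemma Delta'_eps3 : 1000 * l <= d * eps ^+ 3.
Proof. have := eps_expr_ge Delta'_gt0 Delta'_eps4; lra. Qed.

Lemma Delta'_eps : 1000 * l <= d * eps.
Proof.
have l0 := ln_card_ge; have h := eps_expr_ge Delta'_gt0 Delta'_eps3.
by have := eps_expr_ge (k := 1) Delta'_gt0 h; rewrite expr1; lra.
Qed.

Lemma Delta'_ge_l : 1000 * l <= d.
Proof.
have l0 := ln_card_ge; have h := Delta'_eps.
by have := eps_expr_ge (k := 0) Delta'_gt0 h; rewrite expr0; lra.
Qed.

Lemma Delta'_ge1 : 500 <= d.
Proof. have := Delta'_ge_l; have := ln_card_ge; lra. Qed.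

Lemma Delta_ge_sqr : d ^+ 2 <= Delta.
Proof.
rewrite -[leRHS]Delta'_expr; apply: ler_weXn2l; first by have := Delta'_ge1;
  lra.
by have := nrounds_gt10; lia.
Qed.

Lemma nparts_ge : Delta / d <= eta%:R.
Proof. exact: nceil_ge. Qed.

Lemma nparts_lt : eta%:R < Delta / d + 1.
Proof. by apply: nceil_lt; rewrite divr_ge0 ?Delta_ge0 // ltW ?Delta'_gt0. Qed.

Lemma Delta_div_ge : d <= Delta / d.
Proof. by rewrite ler_pdivlMr ?Delta'_gt0 // -expr2 Delta_ge_sqr. Qed.

Lemma nparts_gt0 : (0 < eta)%N.
Proof.
rewrite -(ltr0n R); apply: lt_le_trans nparts_ge.
exact: lt_le_trans Delta'_gt0 Delta_div_ge.
Qed.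

Lemma part_bound_ge : 8 / eps ^+ 3 <= D.
Proof.
rewrite ler_pdivrMr ?exprn_gt0 // /part_bound -mulrA mulrDl mul1r.
have := Delta'_eps3; have := ln_card_ge.
have : 0 < eps * (d * eps ^+ 3) by rewrite !mulr_gt0 ?exprn_gt0 ?Delta'_gt0.
lra.
Qed.

Lemma part_bound_ge_d : d <= D.
Proof. by rewrite /part_bound ler_peMl ?(ltW Delta'_gt0) //; have := eps_gt0;
  lra. Qed.

Lemma palette_size_ge : (1 + eps) * D <= q%:R.
Proof. exact: nceil_ge. Qed.

Lemma palette_size_lt : q%:R < (1 + eps) * D + 1.
Proof.
apply: nceil_lt; have := part_bound_ge_d; have := Delta'_ge1;
  have := eps_gt0 => *.
by rewrite mulr_ge0 //; lra.
Qed.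

Lemma palette_size_le : q%:R <= 2 * D.
Proof.
have dD := part_bound_ge_d; have d1 := Delta'_ge1.
have D0 : 0 <= D by lra.
by have := palette_size_lt; have := ler_wpM2r D0 (ltW eps_lt); lra.
Qed.

Lemma degree_le u : #|[set e : edge E | incident u e]|%:R <= Delta.
Proof.
apply: le_trans deg_le_Delta; rewrite ler_nat.
apply: leq_trans (leq_bigmax u); apply/subset_leq_card/subsetP => e.
by rewrite !in_set.
Qed.

Lemma degree_le_card u : (#|[set e : edge E | incident u e]| <= #|V|)%N.
Proof.
rewrite -(card_imset _ val_inj) -cardsT.
apply: leq_trans (leq_imset_card (fun v => [set u; v]) [set: V]).
apply/subset_leq_card/subsetP => _ /imsetP[e + ->].
have /eqP/cards2P[x [y [xy exy]]] := E_simple (valP e).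
rewrite in_set /incident exy in_set2 => /orP[]/eqP ->; apply/imsetP.
  by exists y.
by exists x; rewrite // setUC.
Qed.

Local Notation wJ := (@uniform_pmf R 'I_eta).
Local Notation w := (iid_pmf wJ : {ffun edge E -> 'I_eta} -> R).
Local Notation N := (T.*2).+1.

Definition large_part (om : {ffun edge E -> 'I_eta}) :=
  [exists u, [exists j, D < #|[set e in part om j | incident u e]|%:R]].

(** Below this threshold the bad parts at [u], of degree at most [D] each, contribute at most about
    eps Delta / 2 failed edges. *)
Definition many_cycles (om : {ffun edge E -> 'I_eta}) :=
  [exists u, eps * eta%:R / 2 < #|[set j | has_short_cycle N om u j]|%:R].

Lemma card_expR : #|V|%:R = expR l.
Proof. by rewrite lnK // posrE ltr0n; lia. Qed.

Lemma expR_card6 : expR (- (6 * l)) = (#|V|%:R ^+ 6)^-1.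
Proof. by rewrite expRN -[6 * l]/(6%:R * l) expRM_natl -card_expR. Qed.

(* If d >= n, the degrees are too small for the event; otherwise the number of
   parts is at most n ^ (30 T), which allows a union bound over the parts. *)
Lemma prob_large_part : prob w large_part <= (#|V|%:R ^+ 6)^-1.
Proof.
have wP : pmf w := part_pmfP R E nparts_gt0.
have [dV|dV] := lerP #|V|%:R d.
  rewrite /prob big_pred0 ?invr_ge0 ?exprn_ge0 ?ler0n // => om.
  apply/existsP => -[u /existsP[j]]; rewrite ltNge => /negP; apply.
  apply: le_trans part_bound_ge_d; apply: le_trans dV; rewrite ler_nat.
  apply: leq_trans (degree_le_card u); apply/subset_leq_card/subsetP => e.
  by rewrite !in_set => /andP[].
apply: (@le_trans _ _ (\sum_(u : V) \sum_(j : 'I_eta)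
    expR (- (33 / 100 * eps ^+ 2 * d)))).
  apply: le_trans (prob_exists wP _) _; apply: ler_sum => u _.
  apply: le_trans (prob_exists wP _) _; apply: ler_sum => j _.
  have Sd : #|[set e : edge E | incident u e]|%:R <= d * eta%:R.
    apply: le_trans (degree_le u) _.
    by rewrite -ler_pdivrMl ?Delta'_gt0 // mulrC nparts_ge.
  apply: le_trans (prob_large_degree nparts_gt0 j eps01 Sd).
  apply: prob_sub => // om; rewrite /part_bound.
  have -> : [set e in part om j | incident u e] =
            [set e in [set e | incident u e] | om e == j]; last by [].
  by apply/setP => e; rewrite !in_set andbC.
rewrite !sumr_const card_ord -mulrnA -[leLHS]mulr_natl natrM -expR_card6.
have etaD : eta%:R <= Delta.
  apply: ltW; apply: lt_le_trans nparts_lt _.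
  have dd := Delta_div_ge; have d1 := Delta'_ge1.
  have : Delta = (Delta / d) * d by rewrite divfK // lt0r_neq0 // Delta'_gt0.
  by move: (Delta / d) dd => z dz ->; nra.
have etaV : eta%:R <= expR ((30 * T)%:R * l).
  apply: le_trans etaD _; rewrite -[leLHS]Delta'_expr expRM_natl -card_expR.
  by rewrite lerXn2r ?nnegrE ?ler0n ?(ltW dV) // ltW // Delta'_gt0.
apply: (@le_trans _ _ (expR ((30 * T)%:R * l) * expR l * expR (- (33 / 100 *
  eps ^+ 2 * d)))).
  by rewrite ler_wpM2r ?expR_ge0 // -card_expR ler_wpM2r // ler0n.
rewrite -!expRD ler_expR natrM.
have l2 := ln_card_ge; have e2 : 0 < eps ^+ 2 by rewrite exprn_gt0.
(* After multiplication by [eps ^+ 2] the union over the parts costs at most [30 * l], while the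
   Chernoff exponent supplies [33 * l]. *)
rewrite -(ler_pM2l e2).
have hT : eps ^+ 2 * T%:R * l <= l by rewrite ler_piMl ?nrounds_sqr_le //; lra.
have h4 : eps ^+ 2 * (eps ^+ 2 * d) >= 100 * l.
  by apply: le_trans Delta'_eps4 _; rewrite mulrA -exprD mulrC.
have he : eps ^+ 2 * l <= 1 / 100 * l.
  rewrite ler_wpM2r //; first lra.
  have := eps_gt0; have := eps_lt; rewrite expr2; nra.
move: hT h4 he; lra.
Qed.

(** The trails with m + 1 edges weigh at most Delta^m (d / Delta)^(m+1) = d^(m+1) / Delta. The
    number of lengths and the factor e^(4/eps) are at most d^T each, so the total is at most
    d^(4T+2) / Delta, and Delta = d^(30T). *)
Lemma short_cycle_weight u :
  expR (4 / eps) * \sum_(C in short_cycles E N u) eta%:R^-1 ^+ #|C| <= 1.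
Proof.
have T30 : (T + T + N.+1 <= 30 * T)%N.
  by move: nrounds_gt10; move: T => t; lia.
have d0 := Delta'_gt0; have d500 := Delta'_ge1.
have d1 : 1 <= d by lra.
have d4 : 4%:R <= d by lra.
have d256 : 256%:R <= d by lra.
have Delta0 : 0 < Delta by apply: lt_le_trans Delta_ge_sqr; rewrite exprn_gt0.
have eta0 : 0 < eta%:R :> R by rewrite ltr0n nparts_gt0.
have y0 : 0 <= eta%:R^-1 :> R by rewrite invr_ge0 ltW.
have yd : eta%:R^-1 <= d / Delta.
  by rewrite -[leRHS]invf_div lef_pV2 ?posrE ?divr_gt0 // nparts_ge.
set S := \sum_(C in _) _.
have S_le : S <= N.+1%:R * (d ^+ N.+1 / Delta).
  rewrite /S; apply: le_trans (sum_short_cycles _ _ _ y0) _.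
  apply: (@le_trans _ _ (\sum_(m < N.+1) d ^+ N.+1 / Delta)); last first.
    by rewrite sumr_const card_ord mulr_natl.
  rewrite [leLHS]big_mkcond; apply: ler_sum => m _; case: ifP => _; last first.
    by rewrite divr_ge0 ?exprn_ge0 ?ltW.
  apply: (@le_trans _ _ (Delta ^+ m * (d / Delta) ^+ m.+1)).
    by rewrite ler_pM ?exprn_ge0 ?ler0n // lerXn2r ?nnegrE ?ler0n ?divr_ge0
      // ltW.
  have -> : Delta ^+ m * (d / Delta) ^+ m.+1 = d ^+ m.+1 / Delta.
    rewrite exprMn exprVn [Delta ^+ m.+1]exprSr; field.
    by rewrite !lt0r_neq0 // exprn_gt0.
  rewrite ler_wpM2r ?invr_ge0 ?(ltW Delta0) //.
  by apply: (ler_weXn2l d1); exact: ltn_ord.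
have eT : expR (4 / eps) <= d ^+ T.
  apply: (@le_trans _ _ (expR (T%:R * 4))).
    by rewrite ler_expR mulrC ler_wpM2r // nrounds_ge.
  rewrite expRM_natl lerXn2r ?nnegrE ?expR_ge0 ?(ltW d0) //.
  have -> : 4 = 8%:R * (1 / 2) :> R by field.
  rewrite expRM_natl; apply: le_trans (lerXn2r 8 _ _ expR_half_le2) _;
    rewrite ?nnegrE ?expR_ge0 //.
  by apply: le_trans d256; rewrite -natrX ler_nat.
have NT : N.+1%:R <= d ^+ T.
  apply: (@le_trans _ _ (4%:R ^+ T)).
    have h := @ltn_expl 2 T isT; have := nrounds_gt10 => T10.
    rewrite -natrX ler_nat (_ : 4 = 2 * 2)%N // expnMn -doubleS -muln2 mulnC.
    by apply: leq_mul => //; apply: leq_trans _ h;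
      apply: leq_trans _ (leqW T10).
  by apply: lerXn2r d4; rewrite nnegrE ?(ltW d0).
apply: (@le_trans _ _ (d ^+ T * (d ^+ T * (d ^+ N.+1 / Delta)))).
  have dD0 : 0 <= d ^+ N.+1 / Delta by rewrite divr_ge0 ?exprn_ge0 ?ltW.
  apply: (@le_trans _ _ (d ^+ T * S)).
    by rewrite ler_wpM2r // sumr_ge0 // => C _; rewrite exprn_ge0.
  rewrite ler_wpM2l ?exprn_ge0 ?(ltW d0) //; apply: le_trans S_le _.
  by rewrite ler_wpM2r.
have -> k : d ^+ T * (d ^+ T * (d ^+ k / Delta)) = d ^+ (T + T + k) / Delta.
  by rewrite !exprD !mulrA.
rewrite ler_pdivrMr // mul1r -[leRHS]Delta'_expr.
exact: (ler_weXn2l d1) T30.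
Qed.

(** With t = 4 / eps and M = eps eta / 2 the exponent eta - t M is - eta, and eta >= Delta / d >= d
    >= 1000 log n outweighs the union over the vertices. *)
Lemma prob_many_cycles : prob w many_cycles <= (#|V|%:R ^+ 6)^-1.
Proof.
have wP : pmf w := part_pmfP R E nparts_gt0.
apply: (@le_trans _ _ (\sum_(u : V) expR (- eta%:R))).
  apply: le_trans (prob_exists wP _) _; apply: ler_sum => u _.
  have t0 : 0 <= 4 / eps by rewrite divr_ge0 // ltW.
  apply: le_trans (prob_many_short_cycles nparts_gt0 _ t0 erefl
                     (short_cycle_weight u)) _.
  rewrite ler_expR le_eqVlt; apply/orP; left; apply/eqP; field.
  by rewrite lt0r_neq0.
rewrite sumr_const -[leLHS]mulr_natl -expR_card6 [X in X * _]card_expR -expRD.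
rewrite ler_expR; have := nparts_ge; have := Delta_div_ge.
have := Delta'_ge_l; have := ln_card_ge; lra.
Qed.

Lemma part_degree_le om : ~~ large_part om ->
  forall u j, #|[set e in part om j | incident u e]|%:R <= D.
Proof.
by move=> /existsPn large u j; have /existsPn/(_ j) := large u; rewrite -leNgt.
Qed.

(** From d^2 <= Delta the exponent is at least 5/4 eps d >= 1250 log n, enough for a union over the
    vertices. *)
Lemma prob_many_failed om : ~~ large_part om ->
  prob (iid_pmf (@nibble_pmf R V E eps D)) (fun sd => [exists u,
    17 * eps * Delta <
    \sum_(j | ~~ has_short_cycle N om u j) #|failed_at om (sd j) u j|%:R]) <=
  (#|V|%:R ^+ 6)^-1.
Proof.
move=> /part_degree_le degD.
have q1 := q_gt1 eps01 part_bound_ge palette_size_ge.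
have sP : pmf (iid_pmf (@nibble_pmf R V E eps D) : {ffun 'I_eta -> _} -> R).
  by apply/iid_pmfP/nibble_pmfP; [rewrite eps_gt0 /=; have := eps_lt;
    lra | exact: ltnW].
apply: le_trans (prob_exists sP _) _.
apply: (@le_trans _ _ (\sum_(u : V) expR (- (5 / 2 * eps * Delta / D)))).
  apply: ler_sum => u _.
  apply: (prob_failed_sum E_simple eps01 part_bound_ge palette_size_ge
            palette_size_le degD).
  exact: degree_le.
rewrite sumr_const -[leLHS]mulr_natl -expR_card6 [X in X * _]card_expR -expRD.
rewrite ler_expR.
have D0 : 0 < D := lt_le_trans Delta'_gt0 part_bound_ge_d.
have : 5 / 4 * (d * eps) <= 5 / 2 * eps * Delta / D.
  rewrite ler_pdivlMr // /part_bound.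
  have h := Delta_ge_sqr.
  have := ler_wpM2l (ltW eps_gt0) h.
  have ed : 0 <= eps * d ^+ 2 by rewrite mulr_ge0 ?sqr_ge0 ?(ltW eps_gt0).
  have el : eps <= 1 by have := eps_lt; lra.
  have : eps * (eps * d ^+ 2) <= eps * d ^+ 2 by rewrite ler_piMl.
  by rewrite expr2; lra.
have := Delta'_eps; have := ln_card_ge; lra.
Qed.

(** The runs own at most (1 + 3 eps) Delta colors. Since m <= 18 eps Delta, the greedy phase adds at
    most 54 eps Delta, for a total of (1 + 57 eps) Delta. *)
Lemma color_count (m : nat) :
  m%:R <= 17 * eps * Delta + eps * eta%:R / 2 * D ->
  (eta * q + 3 * m <= Num.truncn ((1 + 61 * eps) * Delta))%N.
Proof.
move=> mle.
have d0 := Delta'_gt0; have d1 := Delta'_ge1; have de := Delta'_eps.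
have l2 := ln_card_ge; have Delta2 := Delta_ge_sqr.
have Delta0 : 0 < Delta by apply: lt_le_trans Delta_ge_sqr; rewrite exprn_gt0.
(* This bound and the next two make all rounding terms small against eps Delta. *)
have dD : 100 * d <= eps * Delta.
  have := ler_wpM2l (ltW eps_gt0) Delta2; rewrite expr2.
  have : 100 * d <= (d * eps) * d by rewrite ler_wpM2r //; lra.
  lra.
have qD : 100 * (Delta / d) <= eps * Delta.
  rewrite mulrA ler_pdivrMr //.
  have : Delta * 100 <= Delta * (d * eps) by rewrite ler_wpM2l //; lra.
  lra.
have one : 100 <= eps * Delta by lra.
have etaD : eta%:R * d <= Delta + d.
  have := ler_wpM2r (ltW d0) (ltW nparts_lt).
  by rewrite mulrDl divfK ?mul1r // lt0r_neq0.
have eta0 : 0 <= eta%:R :> R by rewrite ler0n.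
have etaDD : eta%:R * D <= (1 + eps) * (1 + eps / 100) * Delta.
  rewrite /part_bound mulrCA -mulrA ler_wpM2l //; first by have := eps_gt0; lra.
  by apply: le_trans etaD _; lra.
have etaDD' : eta%:R * D <= (1 + 12 / 10 * eps) * Delta.
  apply: le_trans etaDD _; rewrite ler_wpM2r // ?(ltW Delta0) //.
  by have := eps_gt0; have := eps_lt; nra.
have etaq : eta%:R * q%:R <= (1 + 3 * eps) * Delta.
  have := ler_wpM2l eta0 (ltW palette_size_lt); rewrite mulrDr mulr1 mulrCA.
  have : (1 + eps) * (eta%:R * D) <= (1 + eps) * ((1 + 12 / 10 * eps) * Delta).
    by rewrite ler_wpM2l //; have := eps_gt0; lra.
  have : (1 + eps) * (1 + 12 / 10 * eps) * Delta <= (1 + 24 / 10 * eps) * Delta.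
    by rewrite ler_wpM2r ?(ltW Delta0) //; have := eps_gt0; have := eps_lt; nra.
  have := nparts_lt; lra.
have half : eps * eta%:R / 2 * D <= eps * Delta.
  have -> : eps * eta%:R / 2 * D = eps * (eta%:R * D / 2) by field.
  rewrite ler_wpM2l ?(ltW eps_gt0) //.
  have : (1 + 12 / 10 * eps) * Delta <= 2 * Delta.
    by rewrite ler_wpM2r ?(ltW Delta0) //; have := eps_lt; lra.
  lra.
have tot : (eta * q + 3 * m)%:R <= (1 + 61 * eps) * Delta.
  by rewrite natrD !natrM; have := mulr_gt0 eps_gt0 Delta0; lra.
have K0 : 0 <= (1 + 61 * eps) * Delta by apply: le_trans tot; rewrite ler0n.
rewrite -ltnS -(ltr_nat R); apply: le_lt_trans tot _.
exact: truncnS_gt.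
Qed.

(** Each bad event has probability at most 1/n^6. The third is bounded conditionally on the
    partition, for partitions outside the first event. *)
Lemma prob_static_color (g : greedy_rule E) :
  1 - 8 / #|V|%:R ^+ 6 <=
    prob (@static_pmf R V E eps Delta)
      (fun omega =>
         proper_edge_coloring (Num.truncn ((1 + 61 * eps) * Delta))
           (static_color g omega)).
Proof.
have q1 := q_gt1 eps01 part_bound_ge palette_size_ge.
have wP : pmf w := part_pmfP R E nparts_gt0.
have sP : pmf (iid_pmf (@nibble_pmf R V E eps D) : {ffun 'I_eta -> _} -> R).
  by apply/iid_pmfP/nibble_pmfP; [rewrite eps_gt0 /=; have := eps_lt;
    lra | exact: ltnW].
have stP : pmf (@static_pmf R V E eps Delta) by exact: prod_pmfP.
set good := (fun omega => _); rewrite (prob_compl stP) lerD2l lerN2.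
set x := (#|V|%:R ^+ 6)^-1.
have x0 : 0 <= x by rewrite invr_ge0 exprn_ge0.
apply: (@le_trans _ _ (3 * x)); last by rewrite -/x; lra.
pose many (om : {ffun edge E -> 'I_eta})
    (sd : {ffun 'I_eta -> nibble_seed E eps D}) := [exists u,
    17 * eps * Delta <
    \sum_(j | ~~ has_short_cycle N om u j) #|failed_at om (sd j) u j|%:R].
have step om sd : ~~ large_part om -> ~~ many_cycles om -> ~~ many om sd ->
    good (om, sd).
  move=> /part_degree_le degD /existsPn cyc /existsPn fail.
  apply: static_color_proper => //; apply: color_count.
  have [u uE] := @bigop.eq_bigmax V (fun u => #|[set e in
    all_failed ((om, sd) : static_seed E eps Delta) | incident u e]|) (ltnW
      V_gt1).
  rewrite /max_degree uE.
  apply: le_trans (@degree_all_failed R V E eps Delta (om, sd)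
    (has_short_cycle N om u) D u (degD u)) _.
  rewrite lerD //; first by rewrite leNgt fail.
  rewrite ler_wpM2r //; last by rewrite leNgt cyc.
  by apply: ltW; apply: lt_le_trans Delta'_gt0 part_bound_ge_d.
rewrite prob_expect /static_pmf expect_pair.
apply: (@le_trans _ _ (expect w (fun om => (large_part om)%:R + (many_cycles
  om)%:R + x))).
  apply: ler_expect => // om; rewrite -prob_expect.
  case: (boolP (large_part om)) => lp.
    by apply: le_trans (prob_le1 sP _) _; rewrite -addrA lerDl addr_ge0.
  case: (boolP (many_cycles om)) => mc.
    by apply: le_trans (prob_le1 sP _) _; rewrite add0r lerDl.
  rewrite !add0r; apply: le_trans (prob_many_failed lp).
  apply: prob_sub => // sd /=; apply: contraR; exact: step.
rewrite !expectD expect_cst // -!prob_expect.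
have := prob_large_part; have := prob_many_cycles; rewrite -/x; lra.
Qed.

End StaticColorBound.

Theorem theoremA2 (R : realType) (eps : R) (V : finType) (E : {set {set V}})
    (Delta : R) (g : greedy_rule E) :
  0 < eps < 1 / 10 ->
  simple_graph E ->
  (100 * ln #|V|%:R / eps ^+ 4) `^ (30 / eps * ln eps^-1) <= Delta ->
  (max_degree [set: edge E])%:R <= Delta ->
  1 - 8 / #|V|%:R ^+ 6 <=
    prob (@static_pmf R V E eps Delta)
      (fun omega =>
         proper_edge_coloring (Num.truncn ((1 + 61 * eps) * Delta))
           (static_color g omega)).
Proof.
move=> eps01 E_simple Delta_ge deg_le.
(* The estimates rest on log n > 0. With at most one vertex there is no edge, and every outcome is a
   proper coloring. *)
case: (ltnP 1 #|V|) => [V1|V1]; first exact: prob_static_color.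
have no_edge (e : edge E) : False.
  by have := max_card (mem (val e)); rewrite (E_simple _ (valP e)); lia.
have E0 : #|edge E| = 0%N by apply: eq_card0 => e; case: (no_edge e).
have stP : pmf (@static_pmf R V E eps Delta).
  by apply: prod_pmfP; [exact: iid_pmf0P | apply/iid_pmfP/iid_pmf0P].
apply: (@le_trans _ _ 1); first by rewrite gerBl divr_ge0 ?exprn_ge0 ?ler0n.
rewrite le_eqVlt; apply/orP; left; apply/eqP.
rewrite /prob -[LHS]stP.2; apply: eq_bigl => omega; symmetry.
by apply/andP; split; apply/forallP => e; case: (no_edge e).
Qed.
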